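(* Let $n\in\mathbb N$, $N=2n$ or $N=2n-1$, $q\in(0,1)$ and $a=(a_1,\dots,a_n)\in\mathbb R_{>0}^n$. Suppose that the process $\mathbf Z=(\mathbf Z(t);t\ge0)$ on $\mathbb K_0^N$ with the dynamics described in the context has initial distribution $M^{(N)}_{a,q}(\cdot;z)$, for some $z\in\mathcal W_0^n$. Then $Z^N=(Z^N(t),t\ge 0)$ is a Markov process in $\mathcal W_0^n$, started at $z$, with transition rates $\{Q_N^q(z,z'):z,z'\in\mathcal W_0^n\}$ given, for $z\ne z'$, by $$Q_N^q(z,z')=\frac{\hat{\mathcal P}^{(N)}_{z'}(a;q)}{\hat{\mathcal P}^{(N)}_{z}(a;q)}f_N(z,z'),\qquad f_N(z,z')=\begin{cases}1-q^{z_{i-1}-z_i}&\text{if }z'-z=e_i,\ 1\le i\le n,\\1-q^{z_i-z_{i+1}}&\text{if }z'-z=-e_i,\ 1\le i\le n,\\0&\text{otherwise,}\end{cases}$$ with the convention $z_0=+\infty$, $z_{n+1}=0$, and diagonal entries $$Q_N^q(z,z)=\begin{cases}-\sum_{i=1}^n(a_i+a_i^{-1}),&N=2n,\\-\sum_{i=1}^{n-1}(a_i+a_i^{-1})-a_n-a_n^{-1}(1-q^{z_n}),&N=2n-1.\end{cases}$$ Moreover, for $t>0$ the conditional law of $\mathbf Z(t)$ given $\{Z^N(s),s\le t\}$ is $M^{(N)}_{a,q}(\cdot;Z^N(t))$.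
   Context: **Patterns.** $\mathcal{W}_0^n=\{z\in\mathbb{Z}^n: z_1\ge\dots\ge z_n\ge 0\}$. $\mathbb{K}_0^{N}$ is the set of patterns $\mathbf z=(z^1,\dots,z^{N})$ with $z^{k}\in\mathbb{Z}_{\ge0}^{[\frac{k+1}2]}$, satisfying (for all levels $\le N$) $z^{2l}_{i+1}\le z^{2l-1}_i\le z^{2l}_i$ for $1\le i\le l$ (with $z^{2l}_{l+1}:=0$) and $z^{2l+1}_{i+1}\le z^{2l}_i\le z^{2l+1}_i$ for $1\le i\le l$. $\mathbb{K}_0^{N}[z]=\{\mathbf z\in\mathbb{K}_0^{N}: z^{N}=z\}$, $|z|=\sum_iz_i$, $|z^0|=0$, $e_i$ standard basis vectors. Set $\bar a_{2l}=a_l^{-1}$, $\bar a_{2l-1}=a_l$. **Dynamics.** $\mathbf Z$ is a continuous-time Markov process on $\mathbb K_0^N$; $Z^k_j$ is the $j$-th particle at level $k$, $1\le j\le[\frac{k+1}2]$, $1\le k\le N$. Put $$R_j(Z^k;Z^{k-1})=(1-q^{Z^{k-1}_{j-1}-Z^k_j})\frac{1-q^{Z^k_j-Z^k_{j+1}+1}}{1-q^{Z^k_j-Z^{k-1}_j+1}},\qquad L_j(Z^k;Z^{k-1})=(1-q^{Z^k_j-Z^{k-1}_j})\frac{1-q^{Z^k_{j-1}-Z^k_j+1}}{1-q^{Z^{k-1}_{j-1}-Z^k_j+1}},$$ with the conventions $Z^k_0=+\infty$ and $Z^k_{[\frac{k+1}2]+1}=0$ for every level $k$ (including $k=0$), $q^{\infty}=0$.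 Each particle $Z^k_j$ independently jumps one step to the right at rate $\bar a_kR_j(Z^k;Z^{k-1})$ and one step to the left at rate $\bar a_k^{-1}L_j(Z^k;Z^{k-1})$. If $Z^k_j=Z^{k+1}_j$ and $Z^k_j$ jumps right, then $Z^{k+1}_j$ is simultaneously pushed one step right; if $Z^k_j=Z^{k+1}_{j+1}$ and $Z^k_j$ jumps left, then $Z^{k+1}_{j+1}$ is simultaneously pushed one step left (a pushed particle pushes particles of the next level by the same rule). **Weights.** $(x;q)_m=\prod_{k=0}^{m-1}(1-xq^k)$, $\binom{m}{k}_q=\frac{(q;q)_m}{(q;q)_k(q;q)_{m-k}}$. For $\mathbf z\in\mathbb K_0^N$, $w^{(N)}_{a,q}(\mathbf z)=\prod_{k=1}^N\Lambda^{\bar a_k,q}_{k-1,k}(z^{k-1},z^k)$ where, for $k=2l$ or $k=2l-1$, $$\Lambda^{\bar a_k,q}_{k-1,k}(z^{k-1},z^k)=\bar a_k^{\,|z^k|-|z^{k-1}|}\prod_{i=1}^{l-1}\binom{z^k_i-z^k_{i+1}}{z^k_i-z^{k-1}_i}_q\Big(\mathbf 1_{\{k=2l-1\}}+\binom{z^k_l}{z^k_l-z^{k-1}_l}_q\mathbf 1_{\{k=2l\}}\Big).$$ $\hat{\mathcal P}^{(N)}_z(a;q)=\sum_{\mathbf z\in\mathbb K_0^N[z]}w^{(N)}_{a,q}(\mathbf z)$ and $M^{(N)}_{a,q}(\mathbf z;z)=w^{(N)}_{a,q}(\mathbf z)/\hat{\mathcal P}^{(N)}_z(a;q)$, a probability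 measure on $\mathbb K_0^N[z]$. *)

(* Defs.v *)
From HB Require Import structures.
From mathcomp Require Import all_boot all_order all_algebra.
From mathcomp Require Import all_classical all_reals all_analysis.
From mathcomp Require Import zify.
Import Order.TTheory GRing.Theory Num.Theory.
Import numFieldNormedType.Exports.

Set Implicit Arguments.
Unset Strict Implicit.
Unset Printing Implicit Defensive.

Local Open Scope classical_set_scope.
Local Open Scope ring_scope.

(* Conventions: levels k and particles j are numbered from 1, and every       *)
(* difference of naturals below is nonnegative on patterns by    *)
(* interlacing, so truncated subtraction is never effective there.            *)

(* The p with p.1 = k - 1 and p.2 = j - 1 stands for the j-th particle of     *)
(* level k, 1 <= k <= N, 1 <= j <= [(k + 1) / 2].                             *)
Definition particle (N : nat) := {p : 'I_N * 'I_N | (p.2 < p.1.+2./2)%N}.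

Definition level N (p : particle N) : nat := (val p).1.+1.
Definition place N (p : particle N) : nat := (val p).2.+1.

Definition array (N : nat) := {ffun particle N -> nat}.

(* Z^k_j, with the convention that it is 0 past the end of a level.           *)
Definition ent N (u : array N) (k j : nat) : nat :=
  if [pick p : particle N | (level p == k) && (place p == j)] is Some p
  then u p else 0%N.

(* z^{k+1}_{i+1} <= z^k_i <= z^{k+1}_i for all levels k < N; for k = 2l - 1   *)
(* and k = 2l these are the two families of inequalities defining patterns.   *)
Definition interlacing N (u : array N) : bool :=
  [forall p : particle N, (level p < N)%N ==>
    (ent u (level p).+1 (place p).+1 <= u p <= ent u (level p).+1 (place p))%N].

Definition pattern (N : nat) := {u : array N | interlacing u}.

(* The cone W_0^n; z_i is z`_i.-1, so that z_{n+1} = 0 holds by default.      *)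
Definition cone (n : nat) := {z : n.-tuple nat | sorted geq z}.

Definition part n (z : cone n) (i : nat) : nat := nth 0%N (val z) i.-1.

Lemma ent_particle N (u : array N) (p : particle N) :
  ent u (level p) (place p) = u p.
Proof.
rewrite /ent; case: pickP => [p' /andP[/eqP e1 /eqP e2]|/(_ p)]; last first.
  by rewrite !eqxx.
congr (u _); apply: val_inj; case: p p' e1 e2 => [[a b] /= h] [[c e] /= h'].
by rewrite /level /place /= => -[e1] [e2]; congr pair; apply: val_inj.
Qed.

Lemma top_decreasing N (x : pattern N) (i : nat) :
  (ent (val x) N i.+2 <= ent (val x) N i.+1)%N.
Proof.
rewrite {1}/ent; case: pickP => [p /andP[/eqP e1 /eqP e2]|//].
case: x => u /= /forallP iu.
have [lp ip] : (val p).1.+1 = N /\ (val p).2 = i.+1 :> nat.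
  by move: e1 e2; rewrite /level /place => -> [->].
have hp := valP p; rewrite /= in hp.
case: N u iu p e1 e2 lp ip hp => [|[|N]] u iu p e1 e2 lp ip hp //.
  by case: p e1 e2 lp ip hp => [[[a ha] b] /= h]; case: a ha h => //= *; lia.
have h2 : (i < N.+2)%N by have := ltn_ord (val p).2; rewrite ip; lia.
have h3 : (N < N.+2)%N by lia.
have h4 : (i < N.+2./2)%N by move: hp; rewrite ip; case: lp => -> /=; lia.
pose r : particle N.+2 :=
  exist (fun p : 'I_N.+2 * 'I_N.+2 => (p.2 < p.1.+2./2)%N)
    (Ordinal h3, Ordinal h2) h4.
have /implyP/(_ (leqnn _))/andP[h5 h6] := iu r.
apply: leq_trans h6; move: h5.
by rewrite -(ent_particle u p) e1 e2.
Qed.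

Lemma top_subproof n N (x : pattern N) :
  sorted geq [tuple ent (val x) N i.+1 | i < n].
Proof.
apply/(sortedP 0%N) => i; rewrite size_tuple => hi.
rewrite -(tnth_nth _ _ (Ordinal hi)) -(tnth_nth _ _ (Ordinal (ltnW hi))).
by rewrite !tnth_mktuple /=; apply: top_decreasing.
Qed.

(* z^N as an element of W_0^n; meant for n = [(N + 1) / 2].                   *)
Definition top_row n N (x : pattern N) : cone n :=
  exist (fun z : n.-tuple nat => sorted geq z) _ (top_subproof n x).

Section Dynamics.
Context {R : realType} (n N : nat) (q : R) (a : n.-tuple R).

(* abar_{2l-1} = a_l and abar_{2l} = 1 / a_l *)
Definition abar (k : nat) : R :=
  let x := a`_((k.-1)%N./2) in if odd k then x else x^-1.

(* Positions and exponents that may be infinite: None is +oo. *)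
Definition xent (u : array N) (k j : nat) : option nat :=
  if j is 0 then None else Some (ent u k j).

Definition xpart (z : cone n) (i : nat) : option nat :=
  if i is 0 then None else Some (part z i).

Definition gap (x : option nat) (y : nat) : option nat :=
  omap (fun m => (m - y)%N) x.

Definition qpow (m : option nat) : R := if m is Some m' then q ^+ m' else 0.

Definition rate_right (u : array N) (k j : nat) : R :=
  (1 - qpow (gap (xent u k.-1 j.-1) (ent u k j))) *
  ((1 - q ^+ (ent u k j - ent u k j.+1 + 1)) /
   (1 - q ^+ (ent u k j - ent u k.-1 j + 1))).

Definition rate_left (u : array N) (k j : nat) : R :=
  (1 - q ^+ (ent u k j - ent u k.-1 j)) *
  ((1 - qpow (omap succn (gap (xent u k j.-1) (ent u k j)))) /
   (1 - qpow (omap succn (gap (xent u k.-1 j.-1) (ent u k j))))).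

Definition incr (u : array N) (k j : nat) : array N :=
  [ffun p => if (level p == k) && (place p == j) then (u p).+1 else u p].

Definition decr (u : array N) (k j : nat) : array N :=
  [ffun p => if (level p == k) && (place p == j) then (u p).-1 else u p].

(* Jump of particle (k, j) together with the cascade of pushes through the m  *)
(* levels above level k. The results need not be patterns when the            *)
(* corresponding rate vanishes.                                               *)
Fixpoint push_right (m : nat) (u : array N) (k j : nat) : array N :=
  let v := incr u k j in
  if m is m'.+1 then
    if ent u k j == ent u k.+1 j then push_right m' v k.+1 j else v
  else v.

Fixpoint push_left (m : nat) (u : array N) (k j : nat) : array N :=
  let v := decr u k j in
  if m is m'.+1 then
    if ent u k j == ent u k.+1 j.+1 then push_left m' v k.+1 j.+1 else v
  else v.

Definition jump_right (u : array N) (p : particle N) : array N :=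
  push_right (N - level p) u (level p) (place p).

Definition jump_left (u : array N) (p : particle N) : array N :=
  push_left (N - level p) u (level p) (place p).

Definition rate_r (u : array N) (p : particle N) : R :=
  abar (level p) * rate_right u (level p) (place p).

Definition rate_l (u : array N) (p : particle N) : R :=
  (abar (level p))^-1 * rate_left u (level p) (place p).

(* Conservative rate matrix: all clocks are independent, so rates add up.     *)
Definition dynamics (x y : pattern N) : R :=
  if x == y then - \sum_(p : particle N) (rate_r (val x) p + rate_l (val x) p)
  else \sum_(p : particle N)
         (rate_r (val x) p *+ (val y == jump_right (val x) p) +
          rate_l (val x) p *+ (val y == jump_left (val x) p)).

Definition qpoch (x : R) (m : nat) : R := \prod_(0 <= k < m) (1 - x * q ^+ k).

Definition qbinom (m k : nat) : R :=
  qpoch q m / (qpoch q k * qpoch q (m - k)).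

Definition lsum (u : array N) (k : nat) : nat :=
  (\sum_(1 <= j < (k.+1./2).+1) ent u k j)%N.

Definition Lambda (u : array N) (k : nat) : R :=
  let l := k.+1./2 in
  abar k ^+ (lsum u k - lsum u k.-1) *
  (\prod_(1 <= i < l)
     qbinom (ent u k i - ent u k i.+1) (ent u k i - ent u k.-1 i)) *
  (if odd k then 1 else qbinom (ent u k l) (ent u k l - ent u k.-1 l)).

Definition weight (x : pattern N) : R := \prod_(1 <= k < N.+1) Lambda (val x) k.

(* A finite sum: the particles of a pattern x are bounded by (top_row n x)_1. *)
Definition Phat (z : cone n) : R :=
  \sum_(x \in [set x : pattern N | top_row n x = z]) weight x.

Definition gibbs (z : cone n) (x : pattern N) : R :=
  if top_row n x == z then weight x / Phat z else 0.

(* z' = z + e_{i+1} *)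
Definition raised (i : 'I_n) (z z' : cone n) : bool :=
  [forall j : 'I_n, tnth (val z') j == (tnth (val z) j + (j == i))%N].

(* At most one summand is nonzero. *)
Definition f_rate (z z' : cone n) : R :=
  \sum_(i < n)
    ((1 - qpow (gap (xpart z i) (part z i.+1))) *+ raised i z z' +
     (1 - q ^+ (part z i.+1 - part z i.+2)) *+ raised i z' z).

Definition Q_rate (z z' : cone n) : R :=
  if z == z' then
    if odd N then
      - (\sum_(0 <= i < n.-1) (a`_i + (a`_i)^-1)) - a`_n.-1
        - (a`_n.-1)^-1 * (1 - q ^+ part z n)
    else - \sum_(0 <= i < n) (a`_i + (a`_i)^-1)
  else Phat z' / Phat z * f_rate z z'.

End Dynamics.

Section MarkovProcesses.
Context {R : realType} {S : countType}.

Definition prob_vector (mu : S -> R) : Prop :=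
  (forall y, 0 <= mu y) /\ \esum_(y in [set: S]) (mu y)%:E = 1%E.

Definition transition_function (p : R -> S -> S -> R) : Prop :=
  [/\ forall (t : R) x, 0 <= t -> prob_vector (p t x),
      forall x y, p 0 x y = (x == y)%:R &
      forall (s t : R) x y, 0 <= s -> 0 <= t ->
        (p (s + t) x y)%:E = \esum_(z in [set: S]) (p s x z * p t z y)%:E].

(* Q is the matrix of transition rates of p: p_h = 1 + h Q + o(h), entrywise. *)
Definition has_rates (p : R -> S -> S -> R) (Q : S -> S -> R) : Prop :=
  forall x y, (p h x y - (x == y)%:R) / h @[h --> 0^'+] --> Q x y.

(* Right-continuous paths with left limits for the discrete topology.         *)
Definition jump_path (f : R -> S) : Prop :=
  forall t : R, 0 <= t -> (\forall s \near t^'+, f s = f t) /\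
    (0 < t -> exists x, \forall s \near t^'-, f s = x).

Context {d : measure_display} {T : measurableType d}.

(* The sigma-algebra generated by the X u, 0 <= u <= t (S being countable).   *)
Definition history (X : R -> T -> S) (t : R) : set (set T) :=
  <<s [set A | exists (u : R) x, [/\ 0 <= u, u <= t & A = X u @^-1` [set x]]] >>.

(* kappa is a (regular) conditional law of X given the sigma-algebra G.       *)
Definition cond_law (P : probability T R) (G : set (set T)) (X : T -> S)
    (kappa : T -> S -> R) : Prop :=
  [/\ forall w, prob_vector (kappa w),
      forall y (B : set R), measurable B -> G [set w | B (kappa w y)] &
      forall y A, G A ->
        P (A `&` X @^-1` [set y]) = (\int[P]_(w in A) (kappa w y)%:E)%E].

(* X = (X t; t >= 0) is a continuous-time Markov process with rate matrix Q,  *)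
(* with respect to its own filtration; X t is irrelevant for t < 0.           *)
Definition markov_process (P : probability T R) (X : R -> T -> S)
    (Q : S -> S -> R) : Prop :=
  [/\ forall (t : R) x, 0 <= t -> measurable (X t @^-1` [set x]),
      {ae P, forall w, jump_path (fun t => X t w)} &
      exists p, [/\ transition_function p, has_rates p Q &
        forall s t : R, 0 <= s -> 0 <= t ->
          cond_law P (history X s) (X (s + t)) (fun w => p t (X s w))]].

End MarkovProcesses.

(* Main.v *)
Require Import Defs.
From mathcomp Require Import all_boot all_order all_algebra.
From mathcomp Require Import all_classical all_reals all_analysis.
From mathcomp Require Import ring lra zify.
Import Order.TTheory GRing.Theory Num.Theory.
Import numFieldNormedType.Exports.
Local Open Scope classical_set_scope.
Local Open Scope ring_scope.

Set Implicit Arguments.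
Unset Strict Implicit.
Unset Printing Implicit Defensive.

(** The top row is a Markov function of the pattern process in the sense of Rogers
    and Pitman. The proof has two independent halves.

    Probability. Let [L] be the generator of the pattern process, [Q] the candidate
    generator for the top row and [M] the Gibbs kernel, which is carried by the
    finite fibres of the map to the top row. Suppose that [M L = Q M] entrywise.
    For a transition function [p] with rates [L], put
    [q t z z' = sum_x M z x * sum_y p t x y], with [x] above [z] and [y] above [z'].
    The difference between [M p] and [q M], at a fixed target, is bounded, starts
    from 0 and satisfies the backward equation of [Q], whose rows are uniformly
    summable; so it vanishes ([gronwall], [intertwining]). Only the first
    short step of [p] is expanded ([backward_step]), so that the errors are uniform
    in time. Then [q] is a transition
    function with rates [Q]. By induction over finitely many observation times of
    the top row, and a pi-lambda argument, [M] gives the law of the pattern given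
    the history of its top row ([history_kernel]), from which the Markov property of
    the top row follows ([markov_function]).

    Algebra. It remains to check [M L = Q M], that is, for a pattern [y], to sum the
    rates of all jumps leading to [y], each multiplied by the ratio of the weights of
    its source and of [y] ([weight_dynamics]). A jump moves a whole cascade of
    particles, vertical for right jumps and diagonal for left jumps. Given the site
    where the cascade stopped, its source is unique, if it exists
    ([right_preimage], [left_preimage]). The weight is a product over the levels,
    and along the cascade the ratios telescope: at its first level, the jump rate
    times the ratio is [1 - q^g], where [g] is a gap within that level alone, and
    each pushed level turns this into the same expression for itself
    ([Lambda_right_start], [Lambda_right_push]). A cascade that reaches the top row
    therefore contributes exactly the rate [f_rate]. A cascade that stops below the
    top contributes a flux depending on two consecutive levels ([right_flux],
    [left_flux]), and these fluxes cancel against the total jump rate of the upper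
    of the two levels, up to a telescoping sum ([level_balance]) whose value yields
    the diagonal of [Q] ([diagonal_rate]).

    The q-binomial weights are rewritten as products over particles
    ([LambdaE]). With entries outside the array equal to 0 and an infinite gap
    contributing 1, the same formulas then hold on even and odd levels. *)

(** * Sums over countable types *)

Section Esum.
Context {R : realType}.

Lemma sum_le_esum (S : choiceType) (F : seq S) (a : S -> \bar R) :
  uniq F -> (forall x, 0 <= a x)%E ->
  (\sum_(x <- F) a x <= \esum_(x in [set: S]) a x)%E.
Proof.
move=> uF a0; apply: esum_ge; exists [set` F]; last first.
  by rewrite -fsbig_seq.
by split => //; exact: finite_seq.
Qed.

Lemma esum_seq (S : choiceType) (F : seq S) (D : set S) (a : S -> \bar R) :
  uniq F -> D = [set` F] -> (forall x, 0 <= a x)%E ->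
  (\esum_(x in D) a x = \sum_(x <- F) a x)%E.
Proof.
move=> uF -> a0; rewrite esum_fset; last by move=> x _; exact: a0.
  by rewrite -fsbig_seq.
exact: finite_seq.
Qed.

Lemma esum_fibers (S U : choiceType) (f : S -> U) (a : S -> \bar R) :
  (forall x, 0 <= a x)%E ->
  (\esum_(x in [set: S]) a x =
   \esum_(z in [set: U]) \esum_(x in f @^-1` [set z]) a x)%E.
Proof.
move=> a0; rewrite esum_esum//.
rewrite (reindex_esum [set: S] _ (fun x => (f x, x)))//; split=> //=.
  by move=> x y _ _ [].
by move=> [z x] [_ /= <-]; exists x.
Qed.

Lemma esum_eq1 (S : choiceType) (x : S) (a : S -> \bar R) :
  (0 <= a x)%E -> (forall y, y != x -> a y = 0%E) ->
  (\esum_(y in [set: S]) a y = a x)%E.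
Proof.
move=> ax0 a0; rewrite (esumID [set x]); last first.
  by move=> y _; have [->//|/a0 ->] := eqVneq y x.
rewrite setTI esum_set1// esum1 ?adde0// => y [_ /eqP yx].
exact: a0.
Qed.

Lemma esumZl (S : choiceType) (D : set S) (c : R) (a : S -> \bar R) :
  0 <= c -> (forall x, 0 <= a x)%E ->
  (\esum_(x in D) (c%:E * a x) = c%:E * \esum_(x in D) a x)%E.
Proof.
move=> c0 a0; rewrite /esum -ereal_supZl//; last first.
  by apply/set0P; eexists; exists set0 => //; exact: fsets_set0.
rewrite image_comp; congr ereal_sup; apply: eq_imagel => F _ /=.
by rewrite ge0_mule_fsumr.
Qed.

(** Truncating a bounded average to finitely many states costs at most the
    mass left out; applying this to both [g] and [1 - g] gives both bounds. *)
Lemma prob_truncation (S : countType) (mu g : S -> R) (v : R) (F : seq S) :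
  prob_vector mu -> (forall x, 0 <= g x <= 1) -> uniq F ->
  v%:E = \esum_(x in [set: S]) (mu x * g x)%:E ->
  \sum_(x <- F) mu x * g x <= v <=
  \sum_(x <- F) mu x * g x + (1 - \sum_(x <- F) mu x).
Proof.
move=> [mu0 mu1] g01 uF vE.
have g0 x : 0 <= g x by case/andP: (g01 x).
have g1 x : 0 <= 1 - g x by rewrite subr_ge0; case/andP: (g01 x).
have lo : \sum_(x <- F) mu x * g x <= v.
  rewrite -lee_fin vE -sumEFin; apply: sum_le_esum => // x.
  by rewrite lee_fin mulr_ge0.
have : (v%:E + \esum_(x in [set: S]) (mu x * (1 - g x))%:E)%E = 1%E.
  rewrite vE -esumD; try by move=> x _; rewrite lee_fin mulr_ge0.
  by rewrite -mu1; apply: eq_esum => x _; rewrite -EFinD; congr EFin; ring.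
have : ((\sum_(x <- F) mu x * (1 - g x))%:E <=
        \esum_(x in [set: S]) (mu x * (1 - g x))%:E)%E.
  rewrite -sumEFin; apply: sum_le_esum => // x.
  by rewrite lee_fin mulr_ge0.
case: (\esum_(x in _) _)%E => [r| |] //=.
rewrite lee_fin -EFinD => rE [] vr.
rewrite lo /=; move: rE.
rewrite (eq_bigr (fun x => mu x - mu x * g x)); last by move=> *; ring.
rewrite sumrB; lra.
Qed.

Lemma prob_vector_le1 (S : countType) (mu : S -> R) x :
  prob_vector mu -> mu x <= 1.
Proof.
move=> [mu0 mu1]; rewrite -lee_fin -mu1.
apply: le_trans (_ : \sum_(y <- [:: x]) (mu y)%:E <= _)%E.
  by rewrite big_seq1.
by apply: sum_le_esum => // y; rewrite lee_fin.
Qed.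

Lemma prob_vector_sum_le1 (S : countType) (mu : S -> R) F :
  prob_vector mu -> uniq F -> \sum_(x <- F) mu x <= 1.
Proof.
move=> [mu0 mu1] uF; rewrite -lee_fin -mu1 -sumEFin.
by apply: sum_le_esum => // y; rewrite lee_fin.
Qed.

End Esum.

(** * A uniqueness principle *)

Section Gronwall.
Context {R : realType}.

(** Uniqueness for a bounded linear evolution that is only known through its
    short forward steps. Summing the steps over a uniform subdivision bounds [D]
    on a window of length [T] by [T * C] times its supremum there; as
    [T * C <= 1/2], that supremum vanishes, and the next window starts from 0
    again. The smallness of [h] may depend on [z] but is uniform in [t], which is
    what lets a single subdivision serve. *)
Lemma gronwall (I : Type) (D : R -> I -> R) (C : R) :
  0 <= C ->
  (forall z, D 0 z = 0) ->
  (forall t z, 0 <= t -> `|D t z| <= 1) ->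
  (forall z e, 0 < e -> \forall h \near (0 : R)^'+, forall t B, 0 <= t ->
     (forall z', `|D t z'| <= B) -> `|D (t + h) z - D t z| <= h * (C * B + e)) ->
  forall t z, 0 <= t -> D t z = 0.
Proof.
move=> C0 D0 Db Ds.
pose T := (2 * (C + 1))^-1.
have T0 : 0 < T by rewrite invr_gt0; lra.
have TC : T * C <= 2^-1.
  rewrite /T invfM -mulrA -[leRHS]mulr1 ler_wpM2l ?invr_ge0//.
  by rewrite mulrC ler_pdivrMr; lra.
(* Halving the bound on one window, provided [D] vanishes where it starts. *)
have half (s B : R) : 0 <= s -> 0 <= B -> (forall z, D s z = 0) ->
    (forall (u : R) z, 0 <= u <= T -> `|D (s + u) z| <= B) ->
    forall (u : R) z, 0 <= u <= T -> `|D (s + u) z| <= B / 2.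
  move=> s0 B0 Ds0 DB u z /andP[u0 uT].
  suff H e : 0 < e -> `|D (s + u) z| <= u * (C * B + e).
    apply/ler_addgt0Pr => e e0.
    have /H : 0 < e / T by rewrite divr_gt0.
    move=> /le_trans; apply.
    apply: (@le_trans _ _ (T * (C * B + e / T))).
      apply: ler_wpM2r => //; apply: addr_ge0; first exact: mulr_ge0.
      by apply: ltW; apply: divr_gt0.
    rewrite mulrDr mulrA mulrCA divff ?gt_eqF// mulr1 lerD2r mulrC.
    by rewrite ler_wpM2l.
  move=> e0; have [->|un0] := eqVneq u 0.
    by rewrite addr0 Ds0 normr0 mul0r.
  have {un0}u0' : 0 < u by rewrite lt_neqAle eq_sym un0.
  have := Ds z e e0; rewrite near_withinE => /nbhs_ballP[d /= d0 dD].
  (* [m] equal steps of length [h] below the threshold [d] *)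
  pose m := (Num.truncn (u / d)).+1; pose h := u / m%:R.
  have m0 : 0 < m%:R :> R by rewrite ltr0n.
  have h0 : 0 < h by rewrite divr_gt0.
  have hd : h < d.
    rewrite /h ltr_pdivrMr// mulrC -ltr_pdivrMr//.
    by have /andP[] := truncn_itv (ltW (divr_gt0 u0' d0)).
  have step j : (j <= m)%N -> `|D (s + j%:R * h) z| <= (j%:R * h) * (C * B + e).
    elim: j => [_|j IH jm]; first by rewrite !mul0r addr0 Ds0 normr0.
    have jh0 : 0 <= j%:R * h by rewrite mulr_ge0// ltW.
    have jhT : j%:R * h <= T.
      apply: le_trans uT; rewrite /h mulrCA ler_piMr// ler_pdivrMr// mul1r.
      by rewrite ler_nat ltnW.
    rewrite (_ : s + j.+1%:R * h = (s + j%:R * h) + h); last first.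
      by rewrite -natr1; ring.
    have /= := dD h _ h0 (s + j%:R * h) B _ _.
    rewrite /ball /= sub0r normrN gtr0_norm// => /(_ hd) DD.
    rewrite -(subrK (D (s + j%:R * h) z) (D (_ + h) z)).
    apply: le_trans (ler_normD _ _) _.
    rewrite -natr1 mulrDl mul1r mulrDl addrC lerD ?IH 1?ltnW// DD ?addr_ge0//.
    by move=> z'; apply: DB; rewrite jh0 jhT.
  have := step m (leqnn _).
  by rewrite (_ : m%:R * h = u)// /h mulrC divfK// gt_eqF.
have stepT (s : R) : 0 <= s -> (forall z, D s z = 0) ->
    forall (u : R) z, 0 <= u <= T -> D (s + u) z = 0.
  move=> s0 Ds0 u z uT.
  have pow k : forall (u : R) z, 0 <= u <= T -> `|D (s + u) z| <= 2 ^- k.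
    elim: k => [v w /andP[v0 _]|k IH v w vT].
      by rewrite expr0 invr1 Db// addr_ge0.
    rewrite exprS invfM mulrC.
    by apply: half vT => //; rewrite invr_ge0 exprn_ge0.
  apply/eqP; rewrite -normr_eq0 eq_le normr_ge0 andbT.
  apply/ler_addgt0Pr => e e0; rewrite add0r.
  apply: le_trans (pow (Num.truncn e^-1).+1 _ _ uT) _.
  rewrite -[leRHS]invrK lef_pV2 ?posrE ?invr_gt0 ?exprn_gt0//.
  have /andP[_ /ltW/le_trans] := truncn_itv (ltW (eqbRL (invr_gt0 e) e0)).
  by apply; rewrite -natrX ler_nat ltnW// ltn_expl.
have allj j : forall (u : R) z, 0 <= u <= T -> D (j%:R * T + u) z = 0.
  elim: j => [|j IH] u z uT; first by rewrite mul0r stepT.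
  apply: stepT => //; first by rewrite mulr_ge0// ltW.
  by move=> w; rewrite -natr1 mulrDl mul1r IH// lexx ltW.
move=> t z t0; pose j := Num.truncn (t / T).
have /andP[jl jr] := truncn_itv (divr_ge0 t0 (ltW T0)).
rewrite -(subrK (j%:R * T) t) addrC; apply: allj.
rewrite subr_ge0 -ler_pdivlMr// jl /= lerBlDr.
rewrite (_ : T + j%:R * T = j.+1%:R * T); last by rewrite -natr1; ring.
by rewrite -ler_pdivrMr// ltW.
Qed.

End Gronwall.

(** * Discrete random variables *)

Section DiscreteVariables.

Lemma sigma_algebra_setI (T : Type) (G : set (set T)) A B :
  sigma_algebra setT G -> G A -> G B -> G (A `&` B).
Proof. by move=> /(sigma_algebraP (fun _ _ => @subsetT _ _))[_ _ _]; apply. Qed.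

Lemma sigma_algebra_preimage_countable (T : Type) (V : countType)
    (G : set (set T)) (Y : T -> V) (D : set V) :
  sigma_algebra setT G -> (forall v, G (Y @^-1` [set v])) -> G (Y @^-1` D).
Proof.
move=> [G0 GC GU] GY.
pose F k := if unpickle k is Some v then
  if v \in D then Y @^-1` [set v] else set0 else set0.
rewrite (_ : Y @^-1` D = \bigcup_k F k).
  by apply: GU => k; rewrite /F; case: unpickle => // v; case: ifP.
apply/seteqP; split=> [w Dw|w [k _]].
  by exists (pickle (Y w)) => //; rewrite /F pickleK mem_set.
by rewrite /F; case: unpickle => // v; case: ifP => // /set_mem Dv /= ->.
Qed.

Context {R : realType} {d : measure_display} {T : measurableType d}.
Context (P : probability T R) {V : countType}.

(** Transfer from the numbering of [V] by naturals, which is the form in which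
    countable additivity is available. *)
Lemma esum_pickle (h : nat -> \bar R) : (forall k, 0 <= h k)%E ->
  (forall k, (forall v : V, pickle v != k) -> h k = 0%E) ->
  (\esum_(k in [set: nat]) h k = \esum_(v in [set: V]) h (pickle v))%E.
Proof.
move=> h0 hout; rewrite (esumID (range (@pickle V)))// [X in (_ + X)%E]esum1.
  rewrite adde0 setTI esum_image// => v w _ _; exact: (pcan_inj pickleK).
move=> k [_ kout]; apply: hout => v; apply/eqP => vk; apply: kout.
by exists v.
Qed.

Lemma integral_countable (Y : T -> V) (A : set T) (g : V -> R) :
  (forall v, measurable (Y @^-1` [set v])) -> measurable A ->
  (forall v, 0 <= g v) ->
  (\int[P]_(w in A) (g (Y w))%:E =
   \esum_(v in [set: V]) (g v)%:E * P (A `&` Y @^-1` [set v]))%E.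
Proof.
move=> mY mA g0.
pose F k := A `&` (Y @^-1` [set v | pickle v = k]).
have mF k : measurable (F k).
  apply: measurableI => //; apply: sigma_algebra_preimage_countable => //.
  exact: sigma_algebra_measurable.
have FA : A = \bigcup_k F k.
  apply/seteqP; split=> [w Aw|w [k _ []]//].
  by exists (pickle (Y w)).
rewrite {1}FA ge0_integral_bigcup//; first last.
- by move=> i j _ _ [w [[_ /= <-] [_ /= <-]]].
- by move=> w _; rewrite lee_fin.
- rewrite -FA => _ B mB; apply: measurableI => //.
  rewrite (_ : _ @^-1` B = Y @^-1` [set v | B (g v)%:E])//.
  apply: sigma_algebra_preimage_countable => //.
  exact: sigma_algebra_measurable.
rewrite nneseries_esumT; last first.
  by move=> k; apply: integral_ge0 => w _; rewrite lee_fin.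
rewrite esum_pickle.
- apply: eq_esum => v _.
  have -> : F (pickle v) = A `&` Y @^-1` [set v].
    congr (_ `&` _); apply/seteqP; split=> w /= => [|->//].
    exact: (pcan_inj pickleK).
  rewrite -integral_cst; last exact: measurableI.
  by apply: eq_integral => w; rewrite inE => -[_ /= ->].
- by move=> k; apply: integral_ge0 => w _; rewrite lee_fin.
- move=> k kout; rewrite (_ : F k = set0) ?integral_set0//.
  by apply/seteqP; split=> // w [_ /= /eqP]; rewrite (negbTE (kout _)).
Qed.

End DiscreteVariables.

(** * Short-time expansion of a semigroup *)

Section Semigroup.
Context {R : realType} {S : countType} (p : R -> S -> S -> R) (L : S -> S -> R).
Hypothesis tfp : transition_function p.
Hypothesis ratep : has_rates p L.

Let p_prob (t : R) x : 0 <= t -> prob_vector (p t x).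
Proof. by move=> t0; case: tfp => /(_ t x t0). Qed.

Let p_ge0 (t : R) x y : 0 <= t -> 0 <= p t x y.
Proof. by move=> /p_prob-/(_ x)[]. Qed.

Let p_le1 (t : R) x y : 0 <= t -> p t x y <= 1.
Proof. by move=> t0; apply: prob_vector_le1; apply: p_prob. Qed.

(** Distance on [F] between the row of [p h] at [x] and its linearisation
    [1 + h L]. *)
Definition row_error (F : seq S) (h : R) (x : S) : R :=
  \sum_(w <- F) `|p h x w - (x == w)%:R - h * L x w|.

Lemma row_error_small (F : seq S) x (e : R) : 0 < e ->
  \forall h \near (0 : R)^'+, row_error F h x <= h * e.
Proof.
rewrite /row_error; elim: F e => [|w F IH] e e0.
  near=> h; rewrite big_nil mulr_ge0// ltW//.
have e2 : 0 < e / 2 by rewrite divr_gt0.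
have := @ratep x w => /cvgrPdist_le /(_ _ e2) Hw.
near=> h; rewrite big_cons (splitr e) mulrDr lerD//; last first.
  by near: h; exact: IH.
have Hh : `|L x w - (p h x w - (x == w)%:R) / h| <= e / 2 by near: h.
have h0 : 0 < h by [].
rewrite [X in `|X|](_ : _ = - (h * (L x w - (p h x w - (x == w)%:R) / h)));
  last by field; rewrite gt_eqF.
by rewrite normrN normrM gtr0_norm// ler_wpM2l// ltW.
Unshelve. all: by end_near. Qed.

(** The backward equation with an error term that depends neither on the time
    [t] nor on the target [y]: only the first, short step is expanded, and
    conservativity of [L] makes the mass escaping [F] part of the error. *)
Lemma backward_step (F : seq S) x (h t : R) y :
  0 <= h -> 0 <= t -> uniq F -> x \in F -> \sum_(w <- F) L x w = 0 ->
  `|p (h + t) x y - p t x y - h * \sum_(w <- F) L x w * p t w y|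
  <= 2 * row_error F h x.
Proof.
move=> h0 t0 uF xF L0; rewrite /row_error.
(* The mass of [p h x] outside [F] is minus the total error, because the row of
   [L] sums to 0. *)
set e := fun w => p h x w - (x == w)%:R - h * L x w.
have sumx (g : S -> R) : \sum_(w <- F) (x == w)%:R * g w = g x.
  rewrite (bigD1_seq x)//= eqxx mul1r big1 ?addr0// => w wx.
  by rewrite eq_sym (negbTE wx) mul0r.
have sum_e : \sum_(w <- F) e w = \sum_(w <- F) p h x w - 1.
  rewrite /e !sumrB -mulr_sumr L0 mulr0 subr0; congr (_ - _).
  by have := sumx (fun=> 1); under eq_bigr do rewrite mulr1.
have norm_e : `|\sum_(w <- F) e w| <= \sum_(w <- F) `|e w|.
  exact: ler_norm_sum.
case: tfp => _ _ /(_ h t x y h0 t0) /prob_truncation - /(_ F).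
case/(_ (p_prob _ h0) _ uF)/andP => [w|]; first by rewrite p_ge0 ?p_le1.
set P := p (h + t) x y => P1 P2.
have split_e : \sum_(w <- F) e w * p t w y =
    \sum_(w <- F) p h x w * p t w y - p t x y - h * \sum_(w <- F) L x w * p t w y.
  rewrite mulr_sumr -(sumx (fun w => p t w y)) -!sumrB.
  by apply: eq_bigr => w _; rewrite /e; ring.
have norm_ep : `|\sum_(w <- F) e w * p t w y| <= \sum_(w <- F) `|e w|.
  apply: le_trans (ler_norm_sum _ _ _) _; apply: ler_sum => w _.
  by rewrite normrM ler_piMr// ger0_norm ?p_ge0// p_le1.
move: norm_e norm_ep; rewrite split_e sum_e.
set se := \sum_(w <- F) `|e w|.
rewrite !ler_norml => /andP[a1 a2] /andP[b1 b2].
by apply/andP; split; lra.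
Qed.

End Semigroup.

(** * Intertwined generators *)

Section Intertwining.
Context {R : realType} {S U : countType} (f : S -> U) (fib : U -> seq S).
Hypothesis uniq_fib : forall z, uniq (fib z).
Hypothesis mem_fib : forall z x, (x \in fib z) = (f x == z).
Context (M : U -> S -> R) (L : S -> S -> R) (Q : U -> U -> R).
Context (supp : S -> seq S) (C : R).
Hypothesis M_ge0 : forall z x, 0 <= M z x.
Hypothesis M_off : forall z x, f x != z -> M z x = 0.
Hypothesis M_sum : forall z, \sum_(x <- fib z) M z x = 1.
Hypothesis L_off : forall x y, y \notin supp x -> L x y = 0.
Hypothesis L_sum : forall x, \sum_(y <- supp x) L x y = 0.
Hypothesis uniq_supp : forall x, uniq (supp x).
Hypothesis ML_QM : forall z y,
  \sum_(x <- fib z) M z x * L x y = Q z (f y) * M (f y) y.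
Hypothesis Q_off : forall z z', z != z' -> 0 <= Q z z'.
Hypothesis Q_diag : forall z, `|Q z z| <= C.

Lemma fiber_mem z : f @^-1` [set z] = [set` fib z].
Proof. by apply/seteqP; split=> x /=; rewrite mem_fib => /eqP. Qed.

Lemma sum_flatten_fib (zs : seq U) (g : S -> R) :
  \sum_(x <- flatten (map fib zs)) g x = \sum_(z <- zs) \sum_(x <- fib z) g x.
Proof. by rewrite big_flatten big_map. Qed.

Lemma uniq_flatten_fib (zs : seq U) : uniq zs -> uniq (flatten (map fib zs)).
Proof.
elim: zs => //= z zs IH /andP[zzs uzs]; rewrite cat_uniq uniq_fib IH// andbT /=.
apply/hasPn => x /flattenP[_ /mapP[z' z'zs ->]]; rewrite mem_fib => /eqP fx.
by rewrite /= mem_fib; apply: contraNN zzs => /eqP <-; rewrite fx.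
Qed.

Definition reach (z : U) : seq U :=
  undup (z :: flatten [seq map f (supp x) | x <- fib z]).

Definition reach_states (z : U) : seq S := flatten (map fib (reach z)).

Lemma uniq_reach_states z : uniq (reach_states z).
Proof. by apply: uniq_flatten_fib; exact: undup_uniq. Qed.

Lemma mem_reach_states z x : x \in fib z -> x \in reach_states z.
Proof.
move=> xz; apply/flattenP; exists (fib z) => //; apply: map_f.
by rewrite mem_undup mem_head.
Qed.

Lemma supp_reach_states z x : x \in fib z -> {subset supp x <= reach_states z}.
Proof.
move=> xz w wx; apply/flattenP; exists (fib (f w)); last by rewrite mem_fib.
apply: map_f; rewrite mem_undup inE; apply/orP; right.
apply/flattenP; exists (map f (supp x)); last exact: map_f.
by apply/mapP; exists x.
Qed.

Lemma sum_reach_states z x (g : S -> R) : x \in fib z ->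
  \sum_(w <- reach_states z) L x w * g w = \sum_(w <- supp x) L x w * g w.
Proof.
move=> xz; rewrite (bigID (mem (supp x)))/= [X in _ + X]big1 ?addr0; last first.
  by move=> w wx; rewrite L_off ?mul0r.
rewrite -big_filter; apply: perm_big; apply: uniq_perm => //.
  by rewrite filter_uniq// uniq_reach_states.
move=> w; rewrite mem_filter /=; case: (boolP (w \in supp x)) => //= wx.
by rewrite (supp_reach_states xz).
Qed.

Lemma L_sum_reach z x : x \in fib z -> \sum_(w <- reach_states z) L x w = 0.
Proof.
move=> xz; have := sum_reach_states (fun=> 1) xz.
by under eq_bigr do rewrite mulr1; move=> ->; under eq_bigr do rewrite mulr1.
Qed.

(** The form in which [ML_QM] enters the backward equation: the averages over the
    fibres satisfy a closed equation with generator [Q]. *)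
Lemma average_generator z (g : S -> R) :
  \sum_(x <- fib z) M z x * \sum_(w <- reach_states z) L x w * g w =
  \sum_(z' <- reach z) Q z z' * \sum_(w <- fib z') M z' w * g w.
Proof.
transitivity (\sum_(w <- reach_states z) Q z (f w) * (M (f w) w * g w)).
  under eq_bigr do rewrite mulr_sumr.
  rewrite exchange_big; apply: eq_bigr => w _; rewrite mulrA -ML_QM mulr_suml.
  by apply: eq_bigr => x _; rewrite mulrA.
rewrite sum_flatten_fib; apply: eq_bigr => z' _; rewrite mulr_sumr.
by apply: eq_big_seq => w; rewrite mem_fib => /eqP ->.
Qed.

Lemma Q_row_sum z : \sum_(z' <- reach z) Q z z' = 0.
Proof.
have := average_generator z (fun=> 1).
rewrite big_seq big1 => [|x xz]; last first.
  by under eq_bigr do rewrite mulr1; rewrite L_sum_reach ?mulr0.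
move=> E; rewrite [RHS]E; apply: eq_bigr => z' _.
by under eq_bigr do rewrite mulr1; rewrite M_sum mulr1.
Qed.

(** Only the diagonal of [Q] is negative and its rows sum to 0, so a bound on the
    diagonal bounds the absolute row sums. *)
Lemma Q_row_norm z : \sum_(z' <- reach z) `|Q z z'| <= 2 * C.
Proof.
have := Q_row_sum z; have zr : z \in reach z by rewrite mem_undup mem_head.
rewrite (bigD1_seq z)//= ?undup_uniq// [X in _ -> X <= _](bigD1_seq z)//= ?undup_uniq//.
rewrite [X in _ -> _ + X <= _](eq_bigr (fun z' => Q z z')); last first.
  by move=> z' zz'; rewrite ger0_norm// Q_off// eq_sym.
have := Q_diag z; rewrite ler_norml => /andP[q1 q2] q0.
have := Q_diag z; lra.
Qed.

Section Kernel.
Variable p : R -> S -> S -> R.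
Hypothesis tfp : transition_function p.
Hypothesis ratep : has_rates p L.

Let p_prob (t : R) x : 0 <= t -> prob_vector (p t x).
Proof. by move=> t0; case: tfp => /(_ t x t0). Qed.

Let p_ge0 (t : R) x y : 0 <= t -> 0 <= p t x y.
Proof. by move=> /p_prob-/(_ x)[]. Qed.

Let p_le1 (t : R) x y : 0 <= t -> p t x y <= 1.
Proof. by move=> t0; apply: prob_vector_le1; apply: p_prob. Qed.

Definition image_kernel (t : R) (z z' : U) : R :=
  \sum_(x <- fib z) M z x * \sum_(y <- fib z') p t x y.

(* Averaged over [M z] this is the failure of the intertwining relation at [y];
   as a function of [x] it solves the same backward equation as [p t x y]. *)
Let defect (y : S) (t : R) (x : S) : R :=
  p t x y - M (f y) y * \sum_(y' <- fib (f y)) p t x y'.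

Let M_le1 z x : M z x <= 1.
Proof.
have [xz|/M_off ->//] := eqVneq (f x) z.
rewrite -(M_sum z) (bigD1_seq x) ?mem_fib ?xz ?eqxx//= lerDl.
by apply: sumr_ge0.
Qed.

Let defect_bound y t x : 0 <= t -> `|defect y t x| <= 1.
Proof.
move=> t0; rewrite /defect ler_norml; set s := \sum_(y' <- _) _.
have s0 : 0 <= s by apply: sumr_ge0 => y' _; exact: p_ge0.
have s1 : s <= 1 by apply: prob_vector_sum_le1 => //; exact: p_prob.
have Ms0 : 0 <= M (f y) y * s by rewrite mulr_ge0.
have Ms1 : M (f y) y * s <= 1 by rewrite mulr_ile1.
have := p_ge0 x y t0; have := p_le1 x y t0.
by move=> *; apply/andP; split; lra.
Qed.

Let defect_step y (F : seq S) x (h t : R) :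
  0 <= h -> 0 <= t -> uniq F -> x \in F -> \sum_(w <- F) L x w = 0 ->
  `|defect y (h + t) x - defect y t x - h * \sum_(w <- F) L x w * defect y t w|
  <= (1 + (size (fib (f y)))%:R) * (2 * row_error p L F h x).
Proof.
move=> h0 t0 uF xF L0.
pose err y' := p (h + t) x y' - p t x y' - h * \sum_(w <- F) L x w * p t w y'.
have errP y' : `|err y'| <= 2 * row_error p L F h x by exact: backward_step.
rewrite [X in `|X|](_ : _ = err y - M (f y) y * \sum_(y' <- fib (f y)) err y').
  apply: le_trans (ler_normB _ _) _; rewrite mulrDl mul1r lerD// normrM.
  rewrite ger0_norm// -[leRHS]mul1r ler_pM//.
  apply: le_trans (ler_norm_sum _ _ _) _.
  apply: (@le_trans _ _ (\sum_(y' <- fib (f y)) 2 * row_error p L F h x)).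
    by apply: ler_sum => y' _; exact: errP.
  by rewrite big_const_seq count_predT iter_addr_0 [leRHS]mulr_natl.
rewrite /err /defect !sumrB -mulr_sumr exchange_big.
rewrite [X in h * X](eq_bigr (fun w => L x w * p t w y -
   M (f y) y * \sum_(y' <- fib (f y)) L x w * p t w y')); last first.
  by move=> w _; rewrite -mulr_sumr; ring.
by rewrite sumrB -mulr_sumr; ring.
Qed.

(** The averages of the defect over the fibres satisfy the backward equation of
    [Q], whose rows are uniformly summable, and vanish at time 0; by [gronwall]
    they vanish at all times. *)
Lemma intertwining (t : R) z y : 0 <= t ->
  \sum_(x <- fib z) M z x * p t x y = image_kernel t z (f y) * M (f y) y.
Proof.
move=> t0; apply/eqP; rewrite -subr_eq0; apply/eqP.
pose D (t : R) z := \sum_(x <- fib z) M z x * defect y t x.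
transitivity (D t z).
  rewrite /D /defect /image_kernel mulr_suml -sumrB; apply: eq_bigr => x _; ring.
have C0 : 0 <= C by exact: le_trans (Q_diag z).
apply: (@gronwall R U D (2 * C)) t0 => [|w|{}t w t0|w e e0].
- by rewrite mulr_ge0.
- have p0 x y' : p 0 x y' = (x == y')%:R by case: tfp.
  rewrite /D /defect; have [wy|wy] := eqVneq w (f y); last first.
    rewrite big1_seq// => x /andP[_]; rewrite mem_fib => /eqP fx.
    rewrite p0 [x == y]negbTE; last by apply: contraNneq wy => <-; rewrite fx.
    rewrite big1_seq ?mulr0 ?subrr ?mulr0// => y' /andP[_]; rewrite mem_fib => fy'.
    by rewrite p0 [x == y']negbTE//; apply: contraNneq wy => xy'; rewrite -fx xy'.
  have pick x (g : S -> R) : x \in fib w -> \sum_(y' <- fib w) (x == y')%:R * g y' = g x.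
    move=> xw; rewrite (bigD1_seq x)//= eqxx mul1r big1 ?addr0// => y' /negbTE.
    by rewrite eq_sym => ->; rewrite mul0r.
  rewrite -wy big_seq (eq_bigr (fun x => (y == x)%:R * M w x - M w x * M w y)).
    rewrite -big_seq sumrB pick ?mem_fib ?wy// -mulr_suml M_sum mul1r.
    by rewrite subrr.
  move=> x xw; rewrite p0 eq_sym (eq_bigr (fun y' => (x == y')%:R * 1)).
    by rewrite pick//; ring.
  by move=> y' _; rewrite p0 mulr1.
- rewrite /D; apply: le_trans (ler_norm_sum _ _ _) _.
  rewrite -(M_sum w); apply: ler_sum => x _.
  by rewrite normrM ger0_norm// ler_piMr// defect_bound.
(* [K * row_error] bounds the remainder of [defect_step]. *)
- pose K := 2 * (1 + (size (fib (f y)))%:R) : R.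
  have K0 : 0 < K by rewrite /K mulr_gt0// ltr_pwDl.
  have small : \forall h \near (0 : R)^'+,
      forall x, x \in fib w -> K * row_error p L (reach_states w) h x <= h * e.
    have : forall s : seq S, \forall h \near (0 : R)^'+,
        forall x, x \in s -> K * row_error p L (reach_states w) h x <= h * e.
      elim => [|x s IH]; first by near=> h.
      have eK : 0 < e / K by rewrite divr_gt0.
      have Hx := row_error_small ratep (reach_states w) x eK.
      near=> h => x'; rewrite inE => /predU1P[->|]; last by move: x'; near: h.
      rewrite mulrC -ler_pdivlMr// -mulrA; near: h; exact: Hx.
    exact.
  near=> h => s B s0 DB; have h0 : 0 < h by [].
  rewrite (addrC s h) /D -sumrB.
  pose err x := defect y (h + s) x - defect y s x -
    h * \sum_(v <- reach_states w) L x v * defect y s v.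
  rewrite (eq_bigr (fun x => M w x * err x +
     h * (M w x * \sum_(v <- reach_states w) L x v * defect y s v))); last first.
    by move=> x _; rewrite /err; ring.
  rewrite big_split /= -mulr_sumr average_generator addrC.
  apply: le_trans (ler_normD _ _) _; rewrite mulrDr lerD//.
    rewrite normrM gtr0_norm// ler_wpM2l ?(ltW h0)//.
    apply: le_trans (ler_norm_sum _ _ _) _.
    apply: (@le_trans _ _ (\sum_(z' <- reach w) `|Q w z'| * B)).
      by apply: ler_sum => z' _; rewrite normrM ler_wpM2l//; exact: DB.
    rewrite -mulr_suml ler_wpM2r ?Q_row_norm//.
    by apply: le_trans (DB w).
  apply: le_trans (ler_norm_sum _ _ _) _.
  apply: (@le_trans _ _ (\sum_(x <- fib w) M w x * (h * e))); last first.
    by rewrite -mulr_suml M_sum mul1r.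
  rewrite big_seq [leRHS]big_seq; apply: ler_sum => x xw.
  rewrite normrM ger0_norm// ler_wpM2l//.
  have errx := defect_step y (ltW h0) s0 (uniq_reach_states w)
    (mem_reach_states xw) (L_sum_reach xw).
  apply: le_trans errx _; rewrite mulrCA mulrA -/K.
  by move: x xw; near: h.
Unshelve. all: by end_near. Qed.

Let image_ge0 (t : R) z z' : 0 <= t -> 0 <= image_kernel t z z'.
Proof.
move=> t0; apply: sumr_ge0 => x _; rewrite mulr_ge0//; apply: sumr_ge0 => y _.
exact: p_ge0.
Qed.

Let esum_fib (a : S -> R) : (forall x, 0 <= a x) ->
  (\esum_(x in [set: S]) (a x)%:E =
   \esum_(z in [set: U]) (\sum_(x <- fib z) a x)%:E)%E.
Proof.
move=> a0; rewrite (esum_fibers f); last by move=> x; rewrite lee_fin.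
apply: eq_esum => z _; rewrite (esum_seq (uniq_fib z) (fiber_mem z)) ?sumEFin//.
Qed.

Lemma image_kernel_prob (t : R) z : 0 <= t -> prob_vector (image_kernel t z).
Proof.
move=> t0; split=> [z'|]; first exact: image_ge0.
have sum_ge0 x z' : 0 <= \sum_(y <- fib z') p t x y.
  by apply: sumr_ge0 => y _; exact: p_ge0.
rewrite (eq_esum (b := fun z' => (\sum_(x <- fib z) (M z x)%:E *
    (\sum_(y <- fib z') p t x y)%:E)%E)); last first.
  by move=> z' _; rewrite -sumEFin; apply: eq_bigr => x _; rewrite EFinM.
rewrite esum_sum; last by move=> z' x _ _; rewrite mule_ge0 ?lee_fin.
rewrite -(M_sum z) -sumEFin; apply: eq_bigr => x _.
rewrite esumZl//; last by move=> z'; rewrite lee_fin.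
rewrite -esum_fib; last by move=> y; exact: p_ge0.
by have [_ ->] := p_prob x t0; rewrite mule1.
Qed.

(** The Chapman-Kolmogorov equations need [intertwining]: at the intermediate
    time the law inside the fibre must again be given by [M]. *)
Lemma image_kernel_transition : transition_function image_kernel.
Proof.
have [_ p0 pD] := tfp; split=> [t z t0|z z'|s t z z'' s0 t0].
- exact: image_kernel_prob.
- rewrite /image_kernel.
  have E x : x \in fib z -> \sum_(y <- fib z') p 0 x y = (z == z')%:R.
    rewrite mem_fib => /eqP fx; have [zz'|zz'] := eqVneq z z'.
      rewrite (bigD1_seq x) ?mem_fib ?fx ?zz'//= p0 eqxx big1 ?addr0// => y yx.
      by rewrite p0 eq_sym (negbTE yx).
    rewrite big1_seq// => y /andP[_]; rewrite mem_fib p0 => /eqP fy.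
    by rewrite [x == y]negbTE//; apply: contraNneq zz' => xy; rewrite -fx -fy xy.
  rewrite big_seq (eq_bigr (fun x => M z x * (z == z')%:R)); last first.
    by move=> x xz; rewrite E.
  by rewrite -big_seq -mulr_suml M_sum mul1r.
- have nng x w y : 0 <= p s x w * p t w y by rewrite mulr_ge0// p_ge0.
  have -> : (image_kernel (s + t) z z'')%:E = \esum_(w in [set: S])
      (\sum_(x <- fib z) \sum_(y <- fib z'') M z x * (p s x w * p t w y))%:E.
    rewrite /image_kernel -sumEFin.
    transitivity (\esum_(w in [set: S]) \sum_(x <- fib z)
        (\sum_(y <- fib z'') M z x * (p s x w * p t w y))%:E)%E; last first.
      by apply: eq_esum => w _; rewrite sumEFin.
    rewrite esum_sum; last first.
      move=> w x _ _; rewrite lee_fin; apply: sumr_ge0 => y _.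
      by rewrite mulr_ge0.
    apply: eq_bigr => x _.
    transitivity (\esum_(w in [set: S]) \sum_(y <- fib z'')
        (M z x * (p s x w * p t w y))%:E)%E; last first.
      by apply: eq_esum => w _; rewrite sumEFin.
    rewrite esum_sum; last by move=> w y _ _; rewrite lee_fin mulr_ge0.
    rewrite mulr_sumr -sumEFin; apply: eq_bigr => y _.
    rewrite EFinM pD// -esumZl//; last by move=> w; rewrite lee_fin.
  rewrite esum_fib; last first.
    move=> w; apply: sumr_ge0 => x _; apply: sumr_ge0 => y _.
    by rewrite mulr_ge0.
  apply: eq_esum => z' _; congr EFin.
  rewrite [in RHS]/image_kernel mulr_sumr big_seq [RHS]big_seq.
  apply: eq_bigr => w; rewrite mem_fib => /eqP fw.
  rewrite mulrA -{1}fw; have := intertwining z w s0; rewrite fw => <-.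
  rewrite mulr_suml; apply: eq_bigr => x _; rewrite mulr_sumr.
  by apply: eq_bigr => y _; rewrite mulrA.
Qed.

(** The fibres being finite, the entrywise rates of [p] may be averaged term by
    term. *)
Lemma image_kernel_rates : has_rates image_kernel Q.
Proof.
move=> z z'; have [_ q0 _] := image_kernel_transition; have [_ p0 _] := tfp.
have -> : Q z z' = \sum_(x <- fib z) \sum_(y <- fib z') M z x * L x y.
  rewrite exchange_big big_seq (eq_bigr (fun y => Q z z' * M z' y)) => [|y].
    by rewrite -big_seq -mulr_sumr M_sum mulr1.
  by rewrite ML_QM mem_fib => /eqP ->.
have E h : (image_kernel h z z' - (z == z')%:R) / h = \sum_(x <- fib z)
    \sum_(y <- fib z') M z x * ((p h x y - (x == y)%:R) / h).
  rewrite -q0 /image_kernel -sumrB mulr_suml; apply: eq_bigr => x _.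
  rewrite -mulrBr -sumrB -mulrA mulr_suml mulr_sumr; apply: eq_bigr => y _.
  by rewrite p0.
under eq_fun do rewrite E.
apply: (@cvg_big R^o) => [|x _]; first exact: add_continuous.
apply: (@cvg_big R^o) => [|y _]; first exact: add_continuous.
by apply: cvgMr; exact: (@ratep x y).
Qed.

End Kernel.
End Intertwining.

(** * Conditioning on the image of a Markov process *)

Section MarkovFunction.
Context {R : realType} {S U : countType} (f : S -> U) (fib : U -> seq S).
Hypothesis uniq_fib : forall z, uniq (fib z).
Hypothesis mem_fib : forall z x, (x \in fib z) = (f x == z).
Context (M : U -> S -> R) (p : R -> S -> S -> R) (q : R -> U -> U -> R).
Hypothesis M_ge0 : forall z x, 0 <= M z x.
Hypothesis M_off : forall z x, f x != z -> M z x = 0.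
Hypothesis M_sum : forall z, \sum_(x <- fib z) M z x = 1.
Hypothesis tfp : transition_function p.
Hypothesis tfq : transition_function q.
Hypothesis Mp_qM : forall (t : R) z y, 0 <= t ->
  \sum_(x <- fib z) M z x * p t x y = q t z (f y) * M (f y) y.

Context {d : measure_display} {T : measurableType d} (P : probability T R).
Context (X : R -> T -> S) (z0 : U).
Hypothesis mX : forall (t : R) x, 0 <= t -> measurable (X t @^-1` [set x]).
Hypothesis markovX : forall s t : R, 0 <= s -> 0 <= t ->
  cond_law P (history X s) (X (s + t)) (fun w => p t (X s w)).
Hypothesis initX : forall x, P (X 0 @^-1` [set x]) = (M z0 x)%:E.

Local Notation Y := (fun t w => f (X t w)).

Let p_ge0 (t : R) x y : 0 <= t -> 0 <= p t x y.
Proof. by move=> t0; case: tfp => /(_ t x t0)[]. Qed.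

Let q_ge0 (t : R) x y : 0 <= t -> 0 <= q t x y.
Proof. by move=> t0; case: tfq => /(_ t x t0)[]. Qed.

Lemma image_measurable (t : R) (D : set U) : 0 <= t -> measurable (Y t @^-1` D).
Proof.
move=> t0; rewrite (_ : _ @^-1` D = X t @^-1` (f @^-1` D))//.
apply: sigma_algebra_preimage_countable; first exact: sigma_algebra_measurable.
by move=> x; exact: mX.
Qed.

Lemma history_sigma_algebra (V : countType) (Z : R -> T -> V) (t : R) :
  sigma_algebra setT (history Z t).
Proof. exact: smallest_sigma_algebra. Qed.

Lemma history_mem (V : countType) (Z : R -> T -> V) (t u : R) (D : set V) :
  0 <= u -> u <= t -> history Z t (Z u @^-1` D).
Proof.
move=> u0 ut; apply: sigma_algebra_preimage_countable.
  exact: history_sigma_algebra.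
by move=> v; apply: sub_sigma_algebra; exists u, v.
Qed.

Lemma history_measurable (t : R) : history X t `<=` measurable.
Proof.
apply: smallest_sub; first exact: sigma_algebra_measurable.
by move=> _ [u [x [u0 _ ->]]]; exact: mX.
Qed.

Lemma history_image (t : R) : history Y t `<=` history X t.
Proof.
apply: smallest_sub; first exact: history_sigma_algebra.
move=> _ [u [z [u0 ut ->]]].
by have := @history_mem S X t u (f @^-1` [set z]) u0 ut.
Qed.

Let fib_set z : f @^-1` [set z] = [set` fib z].
Proof. by apply/seteqP; split=> x /=; rewrite mem_fib => /eqP. Qed.

Let esum_fib (a : S -> \bar R) : (forall x, 0 <= a x)%E ->
  (\esum_(x in [set: S]) a x =
   \esum_(z in [set: U]) \sum_(x <- fib z) a x)%E.
Proof.
move=> a0; rewrite (esum_fibers f)//.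
by apply: eq_esum => z _; rewrite (esum_seq (uniq_fib z) (fib_set z)).
Qed.

Lemma prob_fiber (A : set T) (t : R) z : 0 <= t -> measurable A ->
  P (A `&` Y t @^-1` [set z]) =
  (\sum_(x <- fib z) P (A `&` X t @^-1` [set x]))%E.
Proof.
move=> t0 mA.
rewrite (_ : Y t @^-1` [set z] = \bigcup_(x in [set` fib z]) X t @^-1` [set x]).
  rewrite setI_bigcupr measure_fin_bigcup.
  - by rewrite -fsbig_seq.
  - exact: finite_seq.
  - by move=> x y _ _ [w [[_ /= <-] [_ /= <-]]].
  - by move=> x _; apply: measurableI => //; exact: mX.
apply/seteqP; split=> [w /= fw|w [x /=]].
  by exists (X t w) => //=; rewrite mem_fib fw.
by rewrite mem_fib => /eqP fx ->.
Qed.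

(** Given that the event [A] has occurred, [M] describes the law of [X t]
    inside its fibre. *)
Definition kernel_in_fibers (t : R) (A : set T) : Prop :=
  forall y, P (A `&` X t @^-1` [set y]) =
    ((M (f y) y)%:E * P (A `&` Y t @^-1` [set (f y)]))%E.

Section Step.
Variables (s t : R) (A : set T).
Hypotheses (s0 : 0 <= s) (t0 : 0 <= t).
Hypotheses (hA : history X s A) (kerA : kernel_in_fibers s A).

Let mA : measurable A. Proof. exact: history_measurable hA. Qed.

Let step_state y : P (A `&` X (s + t) @^-1` [set y]) =
  ((M (f y) y)%:E *
   \esum_(z in [set: U]) ((q t z (f y))%:E * P (A `&` Y s @^-1` [set z])))%E.
Proof.
have [_ _ /(_ y A hA) ->] := markovX s0 t0.
rewrite (@integral_countable _ _ _ P _ (X s) A (fun x => p t x y))//; first last.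
- by move=> x; exact: p_ge0.
- by move=> x; exact: mX.
rewrite esum_fib; last by move=> x; rewrite mule_ge0// lee_fin p_ge0.
rewrite -esumZl//; last by move=> z; rewrite mule_ge0// lee_fin q_ge0.
apply: eq_esum => z _; rewrite muleA -EFinM [M _ _ * _]mulrC -Mp_qM//.
rewrite -sumEFin ge0_sume_distrl; last first.
  by move=> x _; rewrite lee_fin mulr_ge0// p_ge0.
rewrite big_seq [RHS]big_seq; apply: eq_bigr => x; rewrite mem_fib => /eqP fx.
by rewrite kerA fx muleA -EFinM mulrC.
Qed.

(** The Markov property of [X] given [A], averaged over the fibres. *)
Lemma step_image z' : P (A `&` Y (s + t) @^-1` [set z']) =
  (\esum_(z in [set: U]) ((q t z z')%:E * P (A `&` Y s @^-1` [set z])))%E.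
Proof.
rewrite prob_fiber ?addr_ge0//.
set E := (\esum_(z in _) _)%E.
have E0 : (0 <= E)%E by apply: esum_ge0 => z _; rewrite mule_ge0// lee_fin q_ge0.
rewrite big_seq (eq_bigr (fun y => (M z' y)%:E * E)%E).
  rewrite -big_seq -ge0_sume_distrl; last by move=> y _; rewrite lee_fin.
  by rewrite sumEFin M_sum mul1e.
by move=> y; rewrite mem_fib => /eqP fy; rewrite step_state fy.
Qed.

Lemma step_kernel : kernel_in_fibers (s + t) A.
Proof. by move=> y; rewrite step_state step_image. Qed.

Lemma observe_kernel z : kernel_in_fibers s (A `&` Y s @^-1` [set z]).
Proof.
move=> y; have [fy|fy] := eqVneq (f y) z.
  rewrite -!setIA -fy setIid.
  rewrite (_ : Y s @^-1` [set f y] `&` _ = X s @^-1` [set y]) ?kerA//.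
  by apply/seteqP; split=> w /= => [[]//|->].
rewrite -!setIA.
rewrite (_ : Y s @^-1` [set z] `&` X s @^-1` [set y] = set0); last first.
  by apply/seteqP; split=> w //= -[+ wy]; rewrite wy => /eqP; rewrite (negbTE fy).
rewrite (_ : Y s @^-1` [set z] `&` Y s @^-1` [set f y] = set0); last first.
  by apply/seteqP; split=> w //= -[+ wy]; rewrite wy => /eqP; rewrite (negbTE fy).
by rewrite setI0 measure0 mule0.
Qed.

End Step.

Lemma start_kernel : kernel_in_fibers 0 setT.
Proof.
move=> y; rewrite !setTI initX -[Y 0 @^-1` _]setTI prob_fiber//.
under eq_bigr do rewrite setTI initX.
rewrite sumEFin; have [<-|z0y] := eqVneq z0 (f y).
  by rewrite M_sum mule1.
rewrite M_off 1?eq_sym// big1_seq ?mule0// => x; rewrite mem_fib => /andP[_ /eqP fx].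
by rewrite M_off// fx eq_sym.
Qed.

Definition cylinder (l : seq (R * U)) : set T :=
  [set w | all (fun e => f (X e.1 w) == e.2) l].

Lemma cylinder_cons e l :
  cylinder (e :: l) = cylinder l `&` Y e.1 @^-1` [set e.2].
Proof.
apply/seteqP; split=> w; rewrite /cylinder /=.
  by move=> /andP[/eqP].
by move=> [-> ->]; rewrite eqxx.
Qed.

Lemma cylinder_nil : cylinder [::] = setT.
Proof. by apply/seteqP. Qed.

Lemma history_setT (V : countType) (Z : R -> T -> V) (t : R) : history Z t setT.
Proof.
by have [G0 GC _] := history_sigma_algebra Z t; have := GC _ G0; rewrite setD0.
Qed.

Lemma cylinder_history l (t : R) : all (fun e => 0 <= e.1 <= t) l ->
  history X t (cylinder l).
Proof.
elim: l => [_|e l IH /= /andP[/andP[e0 et] /IH hl]].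
  by rewrite cylinder_nil; exact: history_setT.
rewrite cylinder_cons; apply: (sigma_algebra_setI (history_sigma_algebra X t)) => //.
exact: (@history_mem S X t e.1 (f @^-1` [set e.2])).
Qed.

Lemma cylinder_perm l l' : perm_eq l l' -> cylinder l = cylinder l'.
Proof.
by move=> ll'; apply/seteqP; split=> w; rewrite /cylinder /= (perm_all _ ll').
Qed.

Let later (e e' : R * U) := e'.1 <= e.1.

(** Observe the image at increasing times, the list being sorted from the latest
    time to the earliest: between two observations [step_kernel] applies, at an
    observation [observe_kernel]. *)
Lemma sorted_cylinder_kernel l : sorted later l ->
  forall t : R, 0 <= t -> all (fun e => 0 <= e.1 <= t) l ->
  kernel_in_fibers t (cylinder l).
Proof.
elim: l => [_|e l IH]; move=> /=.
  move=> t t0 _; rewrite -[t]add0r cylinder_nil; apply: step_kernel => //.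
    exact: history_setT.
  exact: start_kernel.
rewrite path_sortedE; last by move=> a b c; rewrite /later => /[swap]; exact: le_trans.
move=> /andP[/allP el sl] t t0 /andP[/andP[e0 et] /allP lt].
have le1 : all (fun e' => 0 <= e'.1 <= e.1) l.
  apply/allP => e' e'l; have /andP[-> _] := lt _ e'l.
  by have := el _ e'l.
rewrite -[t](subrK e.1) addrC; apply: step_kernel; rewrite ?subr_ge0 //.

- by apply: cylinder_history => /=; rewrite e0 lexx.
- by rewrite cylinder_cons; apply: observe_kernel => //; exact: IH.
Qed.

(** By the pi-lambda theorem, from the finite cylinders to the whole history. *)
Lemma history_kernel (t : R) : 0 <= t -> forall A, history Y t A ->
  kernel_in_fibers t A.
Proof.
move=> t0.
pose C := [set A | exists2 l, all (fun e => 0 <= e.1 <= t) l & A = cylinder l].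
pose H := [set A | measurable A /\ kernel_in_fibers t A].
have CI : setI_closed C.
  move=> _ _ [l hl ->] [l' hl' ->]; exists (l ++ l').
    by rewrite all_cat hl hl'.
  apply/seteqP; split=> w; rewrite /cylinder /= all_cat; first by case=> -> ->.
  by move=> /andP.
have CH : C `<=` H.
  move=> _ [l hl ->]; split.
    by apply: (@history_measurable t); exact: cylinder_history.
  have pl : perm_eq (sort later l) l by rewrite perm_sort.
  rewrite -(cylinder_perm pl); apply: sorted_cylinder_kernel => //.
    by apply: sort_sorted => a b; exact: le_total.
  by rewrite (perm_all _ pl).
have HT : H setT.
  by apply: CH; exists [::] => //; rewrite cylinder_nil.
have HD : dynkin H.
  split=> //.
    move=> A [mA sA]; split; first exact: measurableC.
    have E B : measurable B -> P (~` A `&` B) = (P (setT `&` B) - P (A `&` B))%E.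
      move=> mB; rewrite setTI setIC -setDE measureD//; last first.
        by rewrite ltey_eq fin_num_measure.
      by rewrite [B `&` A]setIC.
    move=> y; rewrite !E; [|exact: image_measurable|exact: mX].
    have [_ ->] := HT; rewrite sA muleBr//.
    by rewrite fin_num_adde_defr// fin_num_measure//; apply: measurableI => //; exact: image_measurable.
  move=> F tF HF; split; first by apply: bigcup_measurable => k _; case: (HF k).
  have E B : measurable B -> P (\bigcup_k F k `&` B) = (\sum_(k <oo) P (F k `&` B))%E.
    move=> mB; rewrite setI_bigcupl measure_semi_bigcup//.
    - by move=> k; apply: measurableI => //; case: (HF k).
    - exact: trivIset_setIr.
    - by apply: bigcup_measurable => k _; apply: measurableI => //; case: (HF k).
  move=> y; rewrite !E; [|exact: image_measurable|exact: mX].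
  rewrite -nneseriesZl//; apply: eq_eseriesr => k _.
  by case: (HF k).
have sub : history Y t `<=` H.
  have lH : lambda_system setT H by exact/dynkin_lambda_system.
  have CHs : <<s C >> `<=` H.
    by apply: (lambda_system_subset CI lH CH) => B _; exact: subsetT.
  apply: subset_trans CHs.
  apply: sub_sigma_algebra2 => _ [u [z [u0 ut ->]]]; exists [:: (u, z)].
    by rewrite /= u0 ut.
  by rewrite cylinder_cons cylinder_nil setTI.
by move=> A /sub[].
Qed.

Let M_prob z : prob_vector (M z).
Proof.
split=> //; rewrite esum_fib; last by move=> x; rewrite lee_fin.
rewrite (esum_eq1 (x := z)) ?sumEFin ?M_sum//.
move=> z' z'z; rewrite big1_seq// => x /andP[_]; rewrite mem_fib => /eqP fx.
by rewrite M_off// fx.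
Qed.

Lemma image_cond_law (t : R) : 0 <= t ->
  cond_law P (history Y t) (X t) (fun w => M (f (X t w))).
Proof.
move=> t0; split=> [w|y B mB|y A hA]; first exact: M_prob.
  exact: (@history_mem U Y t t [set z | B (M z y)]).
have mA : measurable A by apply: (@history_measurable t); exact: history_image.
rewrite (@integral_countable _ _ _ P _ (Y t) A (fun z => M z y))//; last first.
  by move=> z; exact: image_measurable.
rewrite (history_kernel t0 hA) (esum_eq1 (x := f y))//.
  by rewrite mule_ge0// lee_fin.
by move=> z zy; rewrite M_off ?mul0e// eq_sym.
Qed.

Lemma image_markov (s t : R) : 0 <= s -> 0 <= t ->
  cond_law P (history Y s) (Y (s + t)) (fun w => q t (Y s w)).
Proof.
move=> s0 t0; split=> [w|y B mB|z A hA]; first by case: tfq => /(_ t _ t0).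
  exact: (@history_mem U Y s s [set z | B (q t z y)]).
have hXA := history_image hA.
have mA : measurable A by exact: history_measurable hXA.
rewrite (@integral_countable _ _ _ P _ (Y s) A (fun z' => q t z' z))//.
- exact: (step_image s0 t0 hXA (history_kernel s0 hA)).
- by move=> z'; exact: image_measurable.
- by move=> z'; exact: q_ge0.
Qed.

End MarkovFunction.

(** * Markov functions *)

Section ImageProcess.
Context {R : realType} {S U : countType} (f : S -> U) (fib : U -> seq S).
Hypothesis uniq_fib : forall z, uniq (fib z).
Hypothesis mem_fib : forall z x, (x \in fib z) = (f x == z).
Context (M : U -> S -> R) (L : S -> S -> R) (Q : U -> U -> R).
Context (supp : S -> seq S) (C : R).
Hypothesis M_ge0 : forall z x, 0 <= M z x.
Hypothesis M_off : forall z x, f x != z -> M z x = 0.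
Hypothesis M_sum : forall z, \sum_(x <- fib z) M z x = 1.
Hypothesis L_off : forall x y, y \notin supp x -> L x y = 0.
Hypothesis L_sum : forall x, \sum_(y <- supp x) L x y = 0.
Hypothesis uniq_supp : forall x, uniq (supp x).
Hypothesis ML_QM : forall z y,
  \sum_(x <- fib z) M z x * L x y = Q z (f y) * M (f y) y.
Hypothesis Q_off : forall z z', z != z' -> 0 <= Q z z'.
Hypothesis Q_diag : forall z, `|Q z z| <= C.

(** The criterion of Rogers and Pitman, checked on the generators: the finite
    fibres and the bound on [Q] lift the relation [ML_QM] to the semigroups. *)
Theorem markov_function (d : measure_display) (T : measurableType d)
    (P : probability T R) (X : R -> T -> S) (z0 : U) :
  markov_process P X L ->
  (forall x, P (X 0 @^-1` [set x]) = (M z0 x)%:E) ->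
  [/\ P [set w | f (X 0 w) = z0] = 1%E,
      markov_process P (fun t w => f (X t w)) Q &
      forall t : R, 0 <= t ->
        cond_law P (history (fun s w => f (X s w)) t) (X t)
          (fun w => M (f (X t w)))].
Proof.
move=> [mX pathX [p [tfp ratep markovX]]] initX.
have tfq : transition_function (image_kernel fib M p).
  exact: (image_kernel_transition uniq_fib mem_fib M_ge0 M_off M_sum L_off L_sum
    uniq_supp ML_QM Q_off Q_diag tfp ratep).
have rateq : has_rates (image_kernel fib M p) Q.
  exact: (image_kernel_rates uniq_fib mem_fib M_ge0 M_off M_sum L_off L_sum
    uniq_supp ML_QM Q_off Q_diag tfp ratep).
have Mp_qM (t : R) z y : 0 <= t ->
    \sum_(x <- fib z) M z x * p t x y = image_kernel fib M p t z (f y) * M (f y) y.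
  exact: (intertwining uniq_fib mem_fib M_ge0 M_off M_sum L_off L_sum
    uniq_supp ML_QM Q_off Q_diag tfp ratep).
split.
- rewrite -[X in P X]setTI.
  rewrite (prob_fiber uniq_fib mem_fib P mX z0 (lexx 0) measurableT).
  under eq_bigr do rewrite setTI initX.
  by rewrite sumEFin M_sum.
- split.
  + by move=> t z t0; exact: (@image_measurable R S U f d T X mX t [set z] t0).
  + apply: filterS pathX => w pathw t t0; have [rc ll] := pathw t t0; split.
      by apply: filterS rc => s ->.
    move=> /ll[x lx]; exists (f x).
    by apply: filterS lx => s ->.
  + exists (image_kernel fib M p); split=> // s t s0 t0.
    exact: (image_markov uniq_fib mem_fib M_ge0 M_off M_sum tfp tfq Mp_qM mX markovX initX).
- move=> t t0.
  exact: (image_cond_law uniq_fib mem_fib M_ge0 M_off M_sum tfp tfq Mp_qM mX markovX initX).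
Qed.

End ImageProcess.

(** * Patterns and cascades of pushes *)

Section Arrays.
Context {N : nat}.
Implicit Types (u v : array N) (k l m j i : nat).

Definition site k j : bool := (0 < k <= N)%N && (0 < j <= k.+1./2)%N.

Lemma siteP k j : site k j -> exists p : particle N, level p = k /\ place p = j.
Proof.
move=> /andP[/andP[k0 kN] /andP[j0 jk]].
have hk : (k.-1 < N)%N by lia.
have hj : (j.-1 < N)%N by lia.
have h : (j.-1 < k.-1.+2./2)%N by lia.
exists (exist (fun p : 'I_N * 'I_N => (p.2 < p.1.+2./2)%N)
  (Ordinal hk, Ordinal hj) h).
by rewrite /level /place /=; split; lia.
Qed.

Lemma site_particle (p : particle N) : site (level p) (place p).
Proof.
rewrite /site /level /place; case: p => [[[a ha] [b hb]] /= h]; lia.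
Qed.

Lemma particle_inj (p p' : particle N) :
  level p = level p' -> place p = place p' -> p = p'.
Proof.
case: p p' => [[a b] h] [[c e] h']; rewrite /level /place /= => -[e1] [e2].
by apply: val_inj; congr pair; apply: val_inj.
Qed.

(** Entries off the array are 0, and the interlacing inequalities remain true
    there; this spares all case distinctions at the ends of the levels. *)
Lemma ent_out u k j : ~~ site k j -> ent u k j = 0%N.
Proof.
move=> skj; rewrite /ent; case: pickP => // p /andP[/eqP e1 /eqP e2].
by rewrite -e1 -e2 site_particle in skj.
Qed.

Lemma ent_gt0 u k j : (0 < ent u k j)%N -> site k j.
Proof. by apply: contraTT => /(ent_out u) ->. Qed.

Lemma ent0 u j : ent u 0 j = 0%N. Proof. exact: ent_out. Qed.

Lemma entE (F : nat -> nat -> nat -> nat) u k j : site k j ->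
  ent [ffun p => F (level p) (place p) (u p)] k j = F k j (ent u k j).
Proof. by move=> /siteP[p [<- <-]]; rewrite !ent_particle ffunE. Qed.

Lemma array_eqP u v : (forall k j, site k j -> ent u k j = ent v k j) -> u = v.
Proof.
by move=> h; apply/ffunP => p; rewrite -!ent_particle h// site_particle.
Qed.

Lemma interlacingP u : reflect
  (forall k j, (k < N)%N -> (0 < j)%N ->
     (ent u k.+1 j.+1 <= ent u k j <= ent u k.+1 j)%N) (interlacing u).
Proof.
apply: (iffP forallP) => [h k j kN j0|h p]; last first.
  by apply/implyP => pN; rewrite -(ent_particle u p); apply: h.
have [s|ns] := boolP (site k j).
  have [p [pk pj]] := siteP s; have := h p; rewrite -(ent_particle u p) pk pj.
  by rewrite kN.
rewrite (ent_out u ns) leq0n andbT ent_out//.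
by move: ns; rewrite /site; lia.
Qed.

Lemma pattern_ent (x : pattern N) k j : (k < N)%N -> (0 < j)%N ->
  (ent (val x) k.+1 j.+1 <= ent (val x) k j <= ent (val x) k.+1 j)%N.
Proof. by case: x => u hu; move: k j; exact/interlacingP. Qed.

Lemma ent_le (x : pattern N) k j : (0 < k <= N)%N -> (0 < j)%N ->
  (ent (val x) k j.+1 <= ent (val x) k.-1 j <= ent (val x) k j)%N.
Proof. by move=> kN j0; have := pattern_ent x (k := k.-1) ltac:(lia) j0; rewrite prednK//; lia. Qed.

Lemma xent_eq (u v : array N) k j : ent u k j = ent v k j -> xent u k j = xent v k j.
Proof. by case: j => //= j ->. Qed.

Lemma xent_succ (u : array N) k j : (0 < j)%N -> xent u k j.+1.-1 = Some (ent u k j).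
Proof. by case: j. Qed.

Lemma ent_column_mono (x : pattern N) k l j : (0 < j)%N -> (k <= l <= N)%N ->
  (ent (val x) k j <= ent (val x) l j)%N.
Proof.
move=> j0 /andP[/subnK <-]; elim: (l - k)%N => [|i IH] // h.
apply: leq_trans (IH _) _; first by lia.
by have /andP[] := pattern_ent x (k := i + k) (j := j) ltac:(lia) j0.
Qed.

Lemma ent_diag_mono (x : pattern N) k j i : (0 < j)%N -> (i + k <= N)%N ->
  (ent (val x) (i + k) (i + j) <= ent (val x) k j)%N.
Proof.
move=> j0; elim: i => [|i IH] // h.
apply: leq_trans (IH _); last by lia.
by have /andP[] := pattern_ent x (k := i + k) (j := i + j) ltac:(lia) ltac:(lia).
Qed.

(** A cascade started by particle [j] of level [k] and stopping at level [m] moves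
    the particles of a vertical segment when it goes to the right, and those of a
    diagonal segment when it goes to the left. *)
Definition col_path k m j l i : bool := (k <= l <= m)%N && (i == j).
Definition diag_path k m j l i : bool := (k <= l <= m)%N && (i + k == j + l)%N.

Definition raise (c : nat -> nat -> bool) u : array N :=
  [ffun p => (u p + c (level p) (place p))%N].
Definition lower (c : nat -> nat -> bool) u : array N :=
  [ffun p => (u p - c (level p) (place p))%N].

Lemma ent_raise c u k j : site k j ->
  ent (raise c u) k j = (ent u k j + c k j)%N.
Proof. exact: (entE (fun k j e => (e + c k j)%N)). Qed.

Lemma ent_lower c u k j : ent (lower c u) k j = (ent u k j - c k j)%N.
Proof.
have [s|s] := boolP (site k j); last by rewrite !ent_out.
exact: (entE (fun k j e => (e - c k j)%N)).
Qed.

(** A cascade runs through a block of equal entries, and stops where the block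
    ends. *)
Lemma push_rightP d u k j : (k + d = N)%N -> site k j ->
  exists m, [/\ (k <= m <= N)%N,
    forall l, (k <= l < m)%N -> ent u l j = ent u l.+1 j,
    (m < N)%N -> ent u m j != ent u m.+1 j &
    push_right d u k j = raise (col_path k m j) u].
Proof.
elim: d u k => [|d IH] u k kN skj /=.
  exists k; split; try lia.
  apply/array_eqP => l i s; rewrite ent_raise// /col_path.
  rewrite (entE (fun l i e => if (l == k) && (i == j) then e.+1 else e))//.
  by case: (l =P k) => [->|lk]; case: (i =P j) => //=; lia.
have incrE l i : site l i -> ent (incr u k j) l i =
    (if (l == k) && (i == j) then (ent u l i).+1 else ent u l i).
  exact: (entE (fun l i e => if (l == k) && (i == j) then e.+1 else e)).
have [e|ne] := eqVneq (ent u k j) (ent u k.+1 j); last first.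
  exists k; split=> //; try lia.
  apply/array_eqP => l i s; rewrite ent_raise// /col_path incrE//.
  by case: (l =P k) => [->|lk]; case: (i =P j) => //=; lia.
have sk1 : site k.+1 j by move: skj; rewrite /site; lia.
have [m [km h1 h2 h3]] := IH (incr u k j) k.+1 ltac:(lia) sk1.
have same l : (k < l)%N -> ent (incr u k j) l j = ent u l j.
  move=> kl; have [s|s] := boolP (site l j); last by rewrite !ent_out.
  by rewrite incrE//; case: (l =P k) => //; lia.
exists m; split=> [|l lm|mN|]; first by lia.
- have [->|lk] := eqVneq l k; first by [].
  by have := h1 l ltac:(lia); rewrite !same//; lia.
- by have := h2 mN; rewrite !same//; lia.
- rewrite h3; apply/array_eqP => l i s; rewrite !ent_raise// incrE// /col_path.
  by case: (l =P k) => [->|lk]; case: (i =P j) => //=; lia.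
Qed.

Lemma push_leftP d u k j : (k + d = N)%N -> site k j -> (0 < ent u k j)%N ->
  exists m, [/\ (k <= m <= N)%N,
    forall l, (k <= l < m)%N -> ent u l (j + l - k) = ent u l.+1 (j + l - k).+1,
    (m < N)%N -> ent u m (j + m - k) != ent u m.+1 (j + m - k).+1 &
    push_left d u k j = lower (diag_path k m j) u].
Proof.
elim: d u k j => [|d IH] u k j kN skj pos /=.
  exists k; split; try lia.
  apply/array_eqP => l i s; rewrite ent_lower// /diag_path.
  rewrite (entE (fun l i e => if (l == k) && (i == j) then e.-1 else e))//.
  by case: (l =P k) => [->|lk]; case: (i =P j) => //=; lia.
have decrE l i : ent (decr u k j) l i =
    (if (l == k) && (i == j) then (ent u l i).-1 else ent u l i).
  have [s|s] := boolP (site l i); last by rewrite !ent_out//; case: ifP.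
  exact: (entE (fun l i e => if (l == k) && (i == j) then e.-1 else e)).
have [e|ne] := eqVneq (ent u k j) (ent u k.+1 j.+1); last first.
  exists k; split=> //; try lia.
  - by rewrite addnK.
  - apply/array_eqP => l i s; rewrite ent_lower// /diag_path decrE//.
    by case: (l =P k) => [->|lk]; case: (i =P j) => //=; lia.
have pos1 : (0 < ent (decr u k j) k.+1 j.+1)%N.
  by rewrite decrE -e; case: (k.+1 =P k) => //; lia.
have sk1 : site k.+1 j.+1 := ent_gt0 pos1.
have [m [km h1 h2 h3]] := IH (decr u k j) k.+1 j.+1 ltac:(lia) sk1 pos1.
have same l i : (k < l)%N -> ent (decr u k j) l i = ent u l i.
  by move=> kl; rewrite decrE; case: (l =P k) => //; lia.
have shift l : (k < l)%N -> (j.+1 + l - k.+1 = j + l - k)%N by lia.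
exists m; split=> [|l lm|mN|]; first by lia.
- have [->|lk] := eqVneq l k; first by rewrite addnK.
  by have := h1 l ltac:(lia); rewrite !same ?shift//; lia.
- by have := h2 mN; rewrite !same ?shift//; lia.
- rewrite h3; apply/array_eqP => l i s; rewrite !ent_lower decrE// /diag_path.
  by case: (l =P k) => [->|lk]; case: (i =P j) => //=; lia.
Qed.

(** No neighbour on the level below blocks the jump. *)
Definition free_right u k j : bool := (j == 1)%N || (ent u k j < ent u k.-1 j.-1)%N.
Definition free_left u k j : bool := (ent u k.-1 j < ent u k j)%N.

(** The blocking neighbour of the first particle also bounds, through interlacing,
    all the particles pushed later, so they have room to move as well. *)
Lemma jump_right_interlacing (x : pattern N) (p : particle N) :
  free_right (val x) (level p) (place p) -> interlacing (jump_right (val x) p).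
Proof.
have s := site_particle p; rewrite /jump_right.
move: (level p) (place p) s => k j s fr; have /andP[/andP[k0 kN] /andP[j0 _]] := s.
have [m [km h1 h2 ->]] := push_rightP (val x) (subnKC kN) s.
have const l : (k <= l <= m)%N -> ent (val x) l j = ent (val x) k j.
  move=> /andP[/subnK <-]; elim: (l - k)%N => [|i IH]//= h.
  by rewrite addSn -h1 ?IH//; lia.
apply/interlacingP => l i lN i0; have h := pattern_ent x lN i0.
have [s1|ns] := boolP (site l i); last first.
  rewrite (ent_out _ ns) leq0n andbT [ent _ l.+1 i.+1]ent_out//.
  by move: ns; rewrite /site; lia.
have s2 : site l.+1 i by move: s1; rewrite /site; lia.
apply/andP; split; last first.
  rewrite !ent_raise// /col_path; case: (i =P j) => [ij|ij]; last by rewrite !andbF; lia.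
  subst i; have [lm|lm] := eqVneq l m; last by case/andP: h; lia.
  by subst l; have := h2 lN; case/andP: h; lia.
have [s3|ns] := boolP (site l.+1 i.+1); last by rewrite (ent_out _ ns).
rewrite !ent_raise// /col_path; case: (i.+1 =P j) => [ij|ij]; last first.
  by rewrite andbF; case/andP: h; lia.
case: (boolP (k <= l.+1 <= m)%N) => kl; last by case/andP: h; lia.
have := const _ kl; rewrite ij => ->.
move: fr; rewrite /free_right; case: (j =P 1%N) => [|_ /= fr]; first lia.
have := ent_column_mono x (k := k.-1) (l := l) (j := j.-1) ltac:(lia) ltac:(lia).
by rewrite -ij /= in fr *; lia.
Qed.

Lemma jump_left_interlacing (x : pattern N) (p : particle N) :
  free_left (val x) (level p) (place p) -> interlacing (jump_left (val x) p).
Proof.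
have s := site_particle p; rewrite /jump_left /free_left.
move: (level p) (place p) s => k j s fr; have /andP[/andP[k0 kN] /andP[j0 _]] := s.
have [m [km h1 h2 ->]] := push_leftP (subnKC kN) s (leq_ltn_trans (leq0n _) fr).
have const l : (k <= l <= m)%N -> ent (val x) l (j + l - k) = ent (val x) k j.
  move=> /andP[/subnK <-]; elim: (l - k)%N => [|i IH]//= h; first by rewrite addnK.
  rewrite -IH; last lia.
  by rewrite (h1 (i + k)%N); [congr ent; lia|lia].
apply/interlacingP => l i lN i0; have h := pattern_ent x lN i0.
rewrite !ent_lower /diag_path; apply/andP; split.
  case: (boolP (k <= l <= m)%N) => kl; last by case/andP: h; lia.
  case: (i + k =P j + l)%N => ik; last by case/andP: h; lia.
  have [lm|lm] := eqVneq l m; last by case/andP: h; lia.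
  have ei : i = (j + m - k)%N by lia.
  by subst l i; have := h2 lN; case/andP: h; lia.
case: (boolP (k <= l.+1 <= m)%N) => kl; last by case/andP: h; lia.
case: (i + k =P j + l.+1)%N => ik; last by case/andP: h; lia.
have ei : i = (j + l.+1 - k)%N by lia.
have := const _ kl; rewrite -ei => ->.
have := ent_diag_mono x (k := k.-1) (j := j) (i := (l.+1 - k)%N) j0 ltac:(lia).
rewrite (_ : l.+1 - k + k.-1 = l)%N; last lia.
rewrite (_ : l.+1 - k + j = i)%N; last lia.
lia.
Qed.

(** The lowest level [k] of the block of equal entries below [(m, j)]. In a
    pattern, a cascade to the right that stops at [(m, j)] can only have started
    there: pushes follow equal entries, so not lower, and a source obtained by
    decreasing only the upper part of the block would not be interlacing. *)
Definition right_source u k m j : Prop :=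
  [/\ (0 < k <= m)%N, forall l, (k <= l <= m)%N -> ent u l j = ent u m j &
      (ent u k.-1 j < ent u m j)%N].

Lemma right_source_ex (y : pattern N) m j : (m <= N)%N -> (0 < ent (val y) m j)%N ->
  exists k, right_source (val y) k m j.
Proof.
elim: m => [|m IH] mN pos; first by rewrite ent0 in pos.
have j0 : (0 < j)%N by have /andP[_ /andP[]] := ent_gt0 pos.
have /andP[_] := pattern_ent y (k := m) mN j0.
rewrite leq_eqVlt => /orP[/eqP e|lt]; last first.
  by exists m.+1; split=> //; [lia|move=> l lm; congr ent; lia].
have [k [km h1 h2]] := IH (ltnW mN) ltac:(by rewrite e).
exists k; split; [lia|move=> l kl|by rewrite -e].
have [->|lm] := eqVneq l m.+1; first by [].
by rewrite h1 ?e//; lia.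
Qed.

(** The counterpart for cascades to the left, along a diagonal. *)
Definition left_source u k j m i : Prop :=
  [/\ (0 < k <= m)%N /\ site k j, (i + k = j + m)%N,
      forall l, (k <= l <= m)%N -> ent u l (j + l - k) = ent u m i &
      (j == 1)%N || (ent u m i < ent u k.-1 j.-1)%N].

Lemma left_source_ex (y : pattern N) m i : site m i ->
  exists k j, left_source (val y) k j m i.
Proof.
elim: m i => [|m IH] [|i] s; try by move: s; rewrite /site; lia.
have [i0|i0] := eqVneq i 0%N.
  exists m.+1, i.+1; split; [by split=> //; lia|lia| |by rewrite i0].
  by move=> l lm; congr ent; lia.
have s' : site m i by move: s; rewrite /site; lia.
have mN : (m < N)%N by move: s; rewrite /site; lia.
have /andP[+ _] := pattern_ent y mN (j := i) ltac:(lia).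
rewrite leq_eqVlt => /orP[/eqP e|lt]; last first.
  exists m.+1, i.+1; split; [by split=> //; lia|lia| |by rewrite lt orbT].
  by move=> l lm; congr ent; lia.
have [k [j [[km skj] ij h1 h2]]] := IH i s'.
exists k, j; split; [by split; [lia|]|lia|move=> l kl|by rewrite e].
have [->|lm] := eqVneq l m.+1; first by congr ent; lia.
by rewrite h1 ?e//; lia.
Qed.

(** Whether undoing a cascade that stops at [(m, j)] yields a pattern. Interlacing
    propagates the condition from the end of the cascade to all its levels. On
    the top level the neighbour in the same row takes over the role of the one
    above. *)
Definition good_right u m j : bool := (ent u (minn m.+1 N) j.+1 < ent u m j)%N.

Definition good_left u m i : bool :=
  if (m < N)%N then (ent u m i < ent u m.+1 i)%N
  else (i == 1)%N || (ent u m i < ent u m i.-1)%N.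

Lemma lower_column_interlacing (y : pattern N) k m j : site m j ->
  right_source (val y) k m j -> good_right (val y) m j ->
  interlacing (lower (col_path k m j) (val y)).
Proof.
move=> s [km const low] good; have /andP[/andP[m0 mN] /andP[j0 _]] := s.
apply/interlacingP => l i lN i0; have h := pattern_ent y lN i0.
rewrite !ent_lower /col_path; case: (i =P j) => [ij|ij]; last first.
  case: (i.+1 =P j) => ij'; rewrite ?andbF; case/andP: h; lia.
subst i; apply/andP; split.
  case: (boolP (k <= l <= m)%N) => kl; last by case/andP: h; lia.
  have := ent_column_mono y (k := l.+1) (l := minn m.+1 N) (j := j.+1) ltac:(lia) ltac:(lia).
  by have := const l kl; move: good; rewrite /good_right; lia.
case: (boolP (k <= l.+1 <= m)%N) => kl; last by case/andP: h; lia.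
have [lk|lk] := eqVneq l.+1 k; last by case/andP: h; lia.
by have := const _ kl; move: low; rewrite -lk /=; lia.
Qed.

Lemma raise_diagonal_interlacing (y : pattern N) k j m i : site m i ->
  left_source (val y) k j m i -> good_left (val y) m i ->
  interlacing (raise (diag_path k m j) (val y)).
Proof.
move=> s [[km skj] ij const high] good; have /andP[/andP[m0 mN] /andP[i0 _]] := s.
have /andP[_ /andP[j0 _]] := skj.
apply/interlacingP => l e lN e0; have h := pattern_ent y lN e0.
have [s1|ns] := boolP (site l e); last first.
  rewrite (ent_out _ ns) leq0n andbT [ent _ l.+1 e.+1]ent_out//.
  by move: ns; rewrite /site; lia.
have s2 : site l.+1 e by move: s1; rewrite /site; lia.
apply/andP; split.
  have [s3|ns] := boolP (site l.+1 e.+1); last by rewrite (ent_out _ ns).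
  rewrite !ent_raise// /diag_path.
  case: (boolP (k <= l.+1 <= m)%N) => kl; last by case/andP: h; lia.
  case: (e.+1 + k =P j + l.+1)%N => ek; last by case/andP: h; lia.
  have [lk|lk] := eqVneq l.+1 k; last by case/andP: h; lia.
  have ej : e.+1 = j by lia.
  have := const _ kl; rewrite (_ : j + l.+1 - k = e.+1)%N; last lia.
  move: high; case: (j =P 1%N) => [|_ /=]; first lia.
  by rewrite -lk -ej /=; lia.
rewrite !ent_raise// /diag_path.
case: (boolP (k <= l <= m)%N) => kl; last by case/andP: h; lia.
case: (e + k =P j + l)%N => ek; last by case/andP: h; lia.
have := const l kl; rewrite (_ : j + l - k = e)%N; last lia.
move=> ->; suff : (ent (val y) m i < ent (val y) l.+1 e)%N by lia.
move: good; rewrite /good_left; case: ifP => [mlt|mge].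
  have := ent_diag_mono y (k := l.+1) (j := e) (i := (m - l)%N) e0 ltac:(lia).
  rewrite (_ : m - l + l.+1 = m.+1)%N; last lia.
  by rewrite (_ : m - l + e = i)%N; [lia|lia].
have eN : N = m by lia.
have := ent_diag_mono y (k := l.+1) (j := e) (i := (m - l.+1)%N) e0 ltac:(lia).
rewrite (_ : m - l.+1 + l.+1 = m)%N; last lia.
rewrite (_ : m - l.+1 + e = i.-1)%N; last lia.
by case: eqP => /=; lia.
Qed.

(** The cascade triggered by [p] stops at the site of [e]. *)
Definition end_right u (p e : particle N) : bool :=
  [&& place e == place p, (level p <= level e)%N &
      jump_right u p == raise (col_path (level p) (level e) (place p)) u].

Definition end_left u (p e : particle N) : bool :=
  [&& (place e + level p == place p + level e)%N, (level p <= level e)%N,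
      (0 < u p)%N && (0 < u e)%N & jump_left u p == lower (diag_path (level p) (level e) (place p)) u].

Lemma end_right_unique u p : exists e, forall e', end_right u p e' = (e' == e).
Proof.
have s := site_particle p; have /andP[/andP[k0 kN] /andP[j0 jk]] := s.
have [m [km _ _ h]] := push_rightP u (subnKC kN) s.
have /siteP[e [el ep]] : site m (place p) by rewrite /site; lia.
exists e => e'; rewrite /end_right; apply/idP/eqP => [|->]; last first.
  by rewrite el ep eqxx /jump_right h eqxx; lia.
case/and3P => /eqP ep' le' /eqP; rewrite /jump_right h => E.
apply: particle_inj; rewrite ?ep ?ep' ?el//.
apply/eqP; case: ltngtP => // lt.
  have sm : site m (place p) by rewrite -el -ep site_particle.
  have := congr1 (fun v => ent v m (place p)) E.
  by rewrite !ent_raise// /col_path; lia.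
have sm : site (level e') (place p) by rewrite -ep' site_particle.
have := congr1 (fun v => ent v (level e') (place p)) E.
by rewrite !ent_raise// /col_path; lia.
Qed.

Lemma end_left_unique u p : (0 < ent u (level p) (place p))%N ->
  exists e, forall e', end_left u p e' = (e' == e).
Proof.
move=> pos.
have s := site_particle p; have /andP[/andP[k0 kN] /andP[j0 jk]] := s.
have [m [km h1 _ h]] := push_leftP (subnKC kN) s pos.
have const l : (level p <= l <= m)%N ->
    ent u l (place p + l - level p) = ent u (level p) (place p).
  move=> /andP[/subnK <-]; elim: (l - level p)%N => [|i IH]//= h'; first by rewrite addnK.
  rewrite -IH; last lia.
  by rewrite (h1 (i + level p)%N); [congr ent; lia|lia].
have pos' l : (level p <= l <= m)%N -> (0 < ent u l (place p + l - level p))%N.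
  by move=> /const ->.
have /siteP[e [el ep]] := ent_gt0 (pos' m ltac:(lia)).
exists e => e'; rewrite /end_left; apply/idP/eqP => [|->]; last first.
  rewrite -!ent_particle pos el ep /jump_left h eqxx andbT.
  by have := pos' m ltac:(lia); lia.
case/and4P => /eqP ep' le' /andP[_ ue'] /eqP; rewrite /jump_left h => E.
suff le : level e' = m by apply: particle_inj; lia.
apply/eqP; case: ltngtP => // lt.
  have := congr1 (fun v => ent v m (place p + m - level p)) E.
  by have := pos' m ltac:(lia); rewrite !ent_lower /diag_path; lia.
have := congr1 (fun v => ent v (level e') (place e')) E.
by move: ue'; rewrite -ent_particle !ent_lower /diag_path; lia.
Qed.

Lemma end_rightP u p e : end_right u p e ->
  [/\ place e = place p, (level p <= level e)%N,
      forall l, (level p <= l < level e)%N -> ent u l (place e) = ent u l.+1 (place e) &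
      jump_right u p = raise (col_path (level p) (level e) (place e)) u].
Proof.
have s := site_particle p; have /andP[/andP[k0 kN] /andP[j0 jk]] := s.
have [m [km h1 _ h]] := push_rightP u (subnKC kN) s.
have /siteP[e0 [el ep]] : site m (place p) by rewrite /site; lia.
have e0P : end_right u p e0.
  by rewrite /end_right el ep eqxx /jump_right h eqxx; lia.
have [e1 uni] := end_right_unique u p.
move=> eP; have ee0 : e = e0 by move: eP e0P; rewrite !uni => /eqP -> /eqP ->.
by subst e0; rewrite ep el; split=> //; lia.
Qed.

Lemma right_source_unique u k k' m j :
  right_source u k m j -> right_source u k' m j -> k = k'.
Proof.
move=> [km c l] [km' c' l']; apply/eqP; case: ltngtP => // lt.
  by have := c k'.-1 ltac:(lia); lia.
by have := c' k.-1 ltac:(lia); lia.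
Qed.

Lemma raise_source (x y : pattern N) p e : end_right (val x) p e ->
  val y = jump_right (val x) p ->
  [/\ right_source (val y) (level p) (level e) (place e),
      good_right (val y) (level e) (place e) &
      val x = lower (col_path (level p) (level e) (place e)) (val y)].
Proof.
move=> /end_rightP[ep le const jE]; rewrite jE => yE.
have se := site_particle e; have sp := site_particle p.
have st l : (level p <= l <= level e)%N -> site l (place e).
  by move: sp se; rewrite -ep /site; lia.
have c l : (level p <= l <= level e)%N ->
    ent (val x) l (place e) = ent (val x) (level p) (place e).
  move=> /andP[/subnK <-]; elim: (l - level p)%N => [|i IH]//= h.
  by rewrite addSn -const ?IH//; lia.
have /andP[/andP[k0 kN] /andP[j0 jk]] := se.
split.
- split; first by move: sp; rewrite /site; lia.
    by move=> l kl; rewrite yE !ent_raise// ?st// /col_path ?c//; lia.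
  have /andP[_ h] := pattern_ent x (k := (level p).-1) (j := place e)
    ltac:(move: sp; rewrite /site; lia) j0.
  rewrite yE (ent_raise _ _ se) /col_path c; last lia.
  have [s1|ns] := boolP (site (level p).-1 (place e)); last by rewrite (ent_out _ ns); lia.
  rewrite ent_raise//; move: h; rewrite prednK; last by move: sp; rewrite /site; lia.
  by move: sp; rewrite /site; lia.
- rewrite /good_right yE (ent_raise _ _ se).
  have [s1|ns] := boolP (site (minn (level e).+1 N) (place e).+1); last first.
    by rewrite (ent_out _ ns) /col_path; lia.
  rewrite ent_raise// /col_path.
  have [lt|ge] := ltnP (level e) N.
    have /andP[h _] := pattern_ent x lt j0.
    by rewrite (minn_idPl lt); lia.
  have eN : minn (level e).+1 N = level e by lia.
  rewrite eN.
  have /andP[h1 _] := pattern_ent x (k := (level e).-1) (j := place e) ltac:(lia) j0.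
  have /andP[_ h2] := pattern_ent x (k := (level e).-1) (j := place e) ltac:(lia) j0.
  by move: h1 h2; rewrite prednK//; lia.
- apply/array_eqP => l i s; rewrite ent_lower yE ent_raise//; lia.
Qed.

(** Time reversal: a configuration is reached through at most one cascade to the
    right stopping at a given site. This turns the sum over all past jumps into
    a sum over the sites where they stopped. *)
Lemma right_preimage (y : pattern N) e :
  if good_right (val y) (level e) (place e) then
    exists p0 x0, [/\ right_source (val y) (level p0) (level e) (place e),
      place p0 = place e,
      val x0 = lower (col_path (level p0) (level e) (place e)) (val y) &
      forall (x : pattern N) p, end_right (val x) p e && (val y == jump_right (val x) p)
        = (x == x0) && (p == p0)]
  else forall (x : pattern N) p,
    end_right (val x) p e && (val y == jump_right (val x) p) = false.
Proof.
have se := site_particle e.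
have /andP[/andP[k0 kN] /andP[j0 jk]] := se.
case: ifP => good; last first.
  move=> x p; apply/negP => /andP[eP /eqP yE].
  by have [_ + _] := raise_source eP yE; rewrite good.
have pos : (0 < ent (val y) (level e) (place e))%N.
  by move: good; rewrite /good_right; lia.
have [k src] := right_source_ex kN pos.
have [km const low] := src.
have /siteP[p0 [pk pj]] : site k (place e).
  by apply: (@ent_gt0 (val y)); rewrite const//; lia.
have ix := lower_column_interlacing se src good.
pose x0 : pattern N := exist (fun u => interlacing u) _ ix.
have x0E : val x0 = lower (col_path k (level e) (place e)) (val y) by [].
have sp := site_particle p0.
exists p0, x0; rewrite pk; split=> // x p; apply/idP/andP; last first.
  move=> [/eqP -> /eqP ->].
  have [m [km' h1 h2 h]] := push_rightP (val x0) (subnKC (n := N) (m := k) ltac:(lia))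
    (j := place e) ltac:(by rewrite -pk -pj).
  have x0l l : (k <= l <= level e)%N ->
      ent (val x0) l (place e) = (ent (val y) (level e) (place e)).-1.
    by move=> kl; rewrite x0E ent_lower const// /col_path; lia.
  have em : m = level e.
    apply/eqP; case: ltngtP => // lt.
      have /eqP[] := h2 ltac:(lia); rewrite !x0l//; lia.
    have := h1 (level e) ltac:(lia); rewrite x0l; last lia.
    rewrite x0E ent_lower /col_path.
    have /andP[_] := pattern_ent y (k := level e) (j := place e) ltac:(lia) j0.
    by lia.
  have jE : jump_right (val x0) p0 = raise (col_path k (level e) (place e)) (val x0).
    by rewrite /jump_right pk pj h em.
  apply/andP; split.
    by rewrite /end_right pj pk eqxx jE eqxx; lia.
  apply/eqP; rewrite jE; apply/array_eqP => l i s.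
  rewrite ent_raise// x0E ent_lower /col_path.
  case: (i =P place e) => [->|]; last by rewrite andbF; lia.
  by case: (boolP (k <= l <= level e)%N) => kl; [rewrite const//; lia|lia].
move=> /andP[eP /eqP yE]; have [src' _ xE] := raise_source eP yE.
have ek := right_source_unique src src'.
split; apply/eqP.
  by apply: val_inj; rewrite xE -ek.
by have [ep _ _ _] := end_rightP eP; apply: particle_inj; rewrite ?pk ?pj.
Qed.

Lemma end_leftP u p e : end_left u p e ->
  [/\ (place e + level p = place p + level e)%N, (level p <= level e)%N,
      forall l, (level p <= l <= level e)%N ->
        ent u l (place p + l - level p) = ent u (level p) (place p),
      (0 < ent u (level p) (place p))%N &
      jump_left u p = lower (diag_path (level p) (level e) (place p)) u].
Proof.
move=> eP; have /and4P[_ _ /andP[+ _] _] := eP; rewrite -ent_particle => pos.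
have s := site_particle p; have /andP[/andP[k0 kN] /andP[j0 jk]] := s.
have [m [km h1 _ h]] := push_leftP (subnKC kN) s pos.
have const l : (level p <= l <= m)%N ->
    ent u l (place p + l - level p) = ent u (level p) (place p).
  move=> /andP[/subnK <-]; elim: (l - level p)%N => [|i IH]//= h'; first by rewrite addnK.
  rewrite -IH; last lia.
  by rewrite (h1 (i + level p)%N); [congr ent; lia|lia].
have posm : (0 < ent u m (place p + m - level p))%N by rewrite const//; lia.
have /siteP[e0 [el ep]] := ent_gt0 posm.
have e0P : end_left u p e0.
  by rewrite /end_left -!ent_particle el ep /jump_left h eqxx andbT pos posm; lia.
have [e1 uni] := end_left_unique pos.
have ee0 : e = e0 by move: eP e0P; rewrite !uni => /eqP -> /eqP ->.
by subst e0; rewrite ep el; split=> //; lia.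
Qed.

Lemma left_source_unique u k k' j j' m i :
  left_source u k j m i -> left_source u k' j' m i -> k = k' /\ j = j'.
Proof.
move=> [[km s] ij c h] [[km' s'] ij' c' h'].
have /andP[_ /andP[j0 _]] := s; have /andP[_ /andP[j0' _]] := s'.
suff kk : k = k' by split=> //; lia.
apply/eqP; case: ltngtP => // lt.
  have := c k'.-1 ltac:(lia); rewrite (_ : j + k'.-1 - k = j'.-1)%N; last lia.
  by move: h'; case: eqP => /=; lia.
have := c' k.-1 ltac:(lia); rewrite (_ : j' + k.-1 - k' = j.-1)%N; last lia.
by move: h; case: eqP => /=; lia.
Qed.

Lemma lower_source (x y : pattern N) p e : end_left (val x) p e ->
  val y = jump_left (val x) p ->
  [/\ left_source (val y) (level p) (place p) (level e) (place e),
      good_left (val y) (level e) (place e) &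
      val x = raise (diag_path (level p) (level e) (place p)) (val y)].
Proof.
move=> /end_leftP[ep le const pos jE]; rewrite jE => yE.
have se := site_particle e; have sp := site_particle p.
have /andP[/andP[k0 kN] /andP[j0 jk]] := se.
have /andP[/andP[k0' kN'] /andP[j0' jk']] := sp.
have epE : place e = (place p + level e - level p)%N by lia.
have xe : ent (val x) (level e) (place e) = ent (val x) (level p) (place p).
  by rewrite epE const//; lia.
have ye : ent (val y) (level e) (place e) = (ent (val x) (level p) (place p)).-1.
  by rewrite yE ent_lower /diag_path xe; lia.
split.
- split; [by split=> //; lia|lia| |].
    by move=> l kl; rewrite ye yE ent_lower const// /diag_path; lia.
  apply/orP; case: (place p =P 1%N) => pj; [by left|right].
  have /andP[h _] := pattern_ent x (k := (level p).-1) (j := (place p).-1)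
    ltac:(lia) ltac:(lia).
  move: h; rewrite !prednK// ye yE ent_lower /diag_path; lia.
- rewrite /good_left; case: ifP => [lt|ge].
    have /andP[_ h] := pattern_ent x lt j0.
    by rewrite ye yE ent_lower /diag_path; lia.
  apply/orP; case: (place e =P 1%N) => pj; [by left|right]; rewrite ye yE ent_lower /diag_path.
  have /andP[h1 _] := pattern_ent x (k := (level e).-1) (j := (place e).-1)
    ltac:(lia) ltac:(lia).
  have /andP[_ h2] := pattern_ent x (k := (level e).-1) (j := (place e).-1)
    ltac:(lia) ltac:(lia).
  by move: h1 h2; rewrite !prednK//; lia.
- apply/array_eqP => l i s; rewrite ent_raise// yE ent_lower.
  rewrite /diag_path; case: (boolP (level p <= l <= level e)%N) => kl; last lia.
  case: (i + level p =P place p + l)%N => il; last lia.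
  by have := const l kl; rewrite (_ : place p + l - level p = i)%N; lia.
Qed.

Lemma left_preimage (y : pattern N) e :
  if good_left (val y) (level e) (place e) then
    exists p0 x0, [/\ left_source (val y) (level p0) (place p0) (level e) (place e),
      val x0 = raise (diag_path (level p0) (level e) (place p0)) (val y) &
      forall (x : pattern N) p, end_left (val x) p e && (val y == jump_left (val x) p)
        = (x == x0) && (p == p0)]
  else forall (x : pattern N) p,
    end_left (val x) p e && (val y == jump_left (val x) p) = false.
Proof.
have se := site_particle e.
have /andP[/andP[k0 kN] /andP[j0 jk]] := se.
case: ifP => good; last first.
  move=> x p; apply/negP => /andP[eP /eqP yE].
  by have [_ + _] := lower_source eP yE; rewrite good.
have [k [j src]] := left_source_ex y se.
have [[km skj] ij const high] := src.
have /siteP[p0 [pk pj]] := skj.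
have ix := raise_diagonal_interlacing se src good.
pose x0 : pattern N := exist (fun u => interlacing u) _ ix.
have x0E : val x0 = raise (diag_path k (level e) j) (val y) by [].
exists p0, x0; rewrite pk pj; split=> // x p; apply/idP/andP; last first.
  move=> [/eqP -> /eqP ->].
  have st l : (k <= l <= level e)%N -> site l (j + l - k).
    by move: skj se; rewrite /site; lia.
  have x0l l : (k <= l <= level e)%N ->
      ent (val x0) l (j + l - k) = (ent (val y) (level e) (place e)).+1.
    by move=> kl; rewrite x0E ent_raise ?st// const// /diag_path; lia.
  have pos : (0 < ent (val x0) k j)%N.
    by have := x0l k ltac:(lia); rewrite addnK => ->.
  have [m [km' h1 h2 h]] := push_leftP (u := val x0) (subnKC (n := N) (m := k) ltac:(lia))
    skj pos.
  have em : m = level e.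
    apply/eqP; case: ltngtP => // lt.
      have /eqP[] := h2 ltac:(lia); rewrite x0l; last lia.
      have := x0l m.+1 ltac:(lia).
      by rewrite (_ : j + m.+1 - k = (j + m - k).+1)%N; [move=> ->|lia].
    have := h1 (level e) ltac:(lia); rewrite x0l; last lia.
    have e1 : (j + level e - k = place e)%N by lia.
    rewrite e1 x0E.
    have [s1|ns] := boolP (site (level e).+1 (place e).+1); last by rewrite (ent_out _ ns).
    rewrite ent_raise// /diag_path.
    have /andP[+ _] := pattern_ent y (k := level e) (j := place e) ltac:(lia) j0.
    by lia.
  have jE : jump_left (val x0) p0 = lower (diag_path k (level e) j) (val x0).
    by rewrite /jump_left pk pj h em.
  apply/andP; split.
    rewrite /end_left -!ent_particle pj pk jE eqxx pos.
    have := x0l (level e) ltac:(lia).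
    by rewrite (_ : j + level e - k = place e)%N; [move=> ->; lia|lia].
  apply/eqP; rewrite jE; apply/array_eqP => l i s.
  by rewrite ent_lower x0E ent_raise//; lia.
move=> /andP[eP /eqP yE]; have [src' _ xE] := lower_source eP yE.
have [ek ej] := left_source_unique src src'.
split; apply/eqP.
  by apply: val_inj; rewrite xE -ek -ej.
by apply: particle_inj; rewrite ?pk ?pj.
Qed.

End Arrays.

(** * Weights along a cascade *)

Section Weights.
Context {R : realType} {n N : nat} (q : R) (a : n.-tuple R).
Hypothesis q_gt0 : 0 < q.
Hypothesis q_lt1 : q < 1.
Hypothesis a_gt0 : forall i : 'I_n, 0 < tnth a i.
Hypothesis N_le : (N <= n.*2)%N.
Implicit Types (x y : pattern N) (k l m j i v : nat) (o : option nat).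

Local Notation phi := (qpoch q q).
Local Notation Lam u k := (Lambda q a (val u) k).

Lemma abar_gt0 k : (0 < k <= N)%N -> 0 < abar a k.
Proof.
move=> kN; have kn : (k.-1./2 < n)%N by lia.
by rewrite /abar -(tnth_nth 0 a (Ordinal kn)); case: ifP; rewrite ?invr_gt0.
Qed.

Lemma phi0 : phi 0 = 1. Proof. by rewrite /qpoch big_nil. Qed.

Lemma phiS m : phi m.+1 = phi m * (1 - q ^+ m.+1).
Proof. by rewrite /qpoch big_nat_recr//= exprS. Qed.

Lemma qpow_lt1 m : q ^+ m.+1 < 1.
Proof. by rewrite exprn_ilt1// ltW. Qed.

Lemma onem_neq0 m : 1 - q ^+ m.+1 != 0.
Proof. by rewrite subr_eq0 eq_sym lt_eqF// qpow_lt1. Qed.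

Lemma phi_gt0 m : 0 < phi m.
Proof.
elim: m => [|m IH]; first by rewrite phi0.
by rewrite phiS mulr_gt0// subr_gt0 qpow_lt1.
Qed.

Lemma phi_neq0 m : phi m != 0. Proof. by rewrite gt_eqF// phi_gt0. Qed.

(** An infinite gap contributes the factor 1, which amounts to normalising by
    [(q; q)] at infinity. *)
Definition phio o : R := if o is Some m then phi m else 1.
Definition below v o : bool := if o is Some m then (v < m)%N else true.

(** The factor gained or lost by [phio] when the gap between [v] and [o] changes
    by one; on the top level it is also the rate [f_rate] of a right jump. *)
Definition gap_rate o v : R := 1 - qpow q (gap o v).

Lemma phio_neq0 o : phio o != 0.
Proof. by case: o => [m|]; rewrite /= ?oner_eq0// phi_neq0. Qed.

Lemma phio_gapS o v : below v o ->
  phio (gap o v) = phio (gap o v.+1) * gap_rate o v.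
Proof.
case: o => [m|] /=; last by rewrite /gap_rate /= subr0 mulr1.
by move=> vm; rewrite /gap_rate /= -subnSK// phiS.
Qed.

Lemma gap_rate_neq0 o v : below v o -> gap_rate o v != 0.
Proof.
case: o => [m|] /=; last by rewrite /gap_rate /= subr0 oner_eq0.
by move=> vm; rewrite /gap_rate /= -subnSK// onem_neq0.
Qed.

Lemma succ_gap o v : below v o -> omap succn (gap o v.+1) = gap o v.
Proof. by case: o => [m|] //= vm; rewrite subnSK. Qed.

(** The factors of [Lambda] attached to the [i]-th particle of level [k]: its share
    of the power of [abar], and its gaps to the neighbours in the same level and
    in the level below. *)
Definition tile (u : array N) k i : R :=
  abar a k ^+ ent u k i / abar a k ^+ ent u k.-1 i *
  (phio (gap (xent u k i.-1) (ent u k i)) /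
   (phi (ent u k i - ent u k.-1 i) * phio (gap (xent u k.-1 i.-1) (ent u k i)))).

Lemma lsumE (u : array N) k : (k <= N)%N ->
  lsum u k = (\sum_(1 <= i < N.+2) ent u k i)%N.
Proof.
move=> kN; rewrite /lsum (big_cat_nat (n := k.+1./2.+1) (p := N.+2)); [|lia|lia].
rewrite [X in _ = (_ + X)%N]big_nat_cond [X in _ = (_ + X)%N]big1 ?addn0// => i.
by rewrite andbT => hi; rewrite ent_out// /site; lia.
Qed.

(** Regrouping the factors of the q-binomials by particle makes both parities of
    [k] uniform: particles beyond the end of a level contribute trivially. *)
Lemma LambdaE x k : (0 < k <= N)%N -> Lam x k = \prod_(1 <= i < N.+2) tile (val x) k i.
Proof.
move=> kN; have A0 := lt0r_neq0 (abar_gt0 kN).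
have [k0 kN'] := andP kN.
have := fun i => @ent_le N x k i kN; move: (val x) => u entle.
rewrite /tile big_split big_split /= prodfV -!expr_sum.
rewrite -!lsumE//; last lia.
have le : (lsum u k.-1 <= lsum u k)%N.
  rewrite !lsumE//; last lia.
  rewrite big_nat_cond [leqRHS]big_nat_cond; apply: leq_sum => i /andP[/andP[i0 _] _].
  by have /andP[] := entle i i0.
rewrite /Lambda -mulrA.
have -> : abar a k ^+ (lsum u k - lsum u k.-1) = abar a k ^+ lsum u k / abar a k ^+ lsum u k.-1.
  by rewrite -{2}(subnK le) exprD mulfK// expf_neq0.
congr (_ * _).
pose bin i := phi (ent u k i - ent u k i.+1) /
  (phi (ent u k i - ent u k.-1 i) * phi (ent u k.-1 i - ent u k i.+1)).
(* Up to a common bound on the places: past the end of the level the binomials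
   are 1, and so is the one at the end when the level is odd. *)
transitivity (\prod_(1 <= i < N.+1) bin i).
  have out i k' : (k.+1./2 < i)%N -> (k' <= k)%N -> ent u k' i = 0%N.
    by move=> ki kk; rewrite ent_out// /site; lia.
  have out1 : odd k -> ent u k.-1 k.+1./2 = 0%N.
    by move=> ok; rewrite ent_out// /site; lia.
  have l0 : (0 < k.+1./2)%N by lia.
  have lN : (k.+1./2 <= N)%N by lia.
  move: (k.+1./2) l0 lN out out1 => l l0 lN out out1.
  have bl : qbinom q (ent u k l) (ent u k l - ent u k.-1 l) = bin l.
    rewrite /qbinom /bin (out l.+1)// !subn0 subKn//.
    by have /andP[] := entle l l0.
  rewrite (big_cat_nat (n := l) (p := N.+1)); [|lia|lia].
  congr (_ * _).
    rewrite big_nat_cond [RHS]big_nat_cond; apply: eq_bigr => i /andP[/andP[i0 _] _].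
    rewrite /qbinom /bin; congr (_ / (_ * phi _)).
    by have /andP[] := entle i i0; lia.
  rewrite big_ltn ?ltnS//.
  rewrite [X in _ = _ * X]big_nat_cond [X in _ = _ * X]big1 ?mulr1; last first.
    move=> i; rewrite andbT => hi.
    by rewrite /bin !out ?subnn ?phi0 ?mulr1 ?divr1//; lia.
  case: ifP => // ok; rewrite /bin out1// (out l.+1)// !subn0 phi0 mulr1 divff//.
  exact: phi_neq0.
rewrite /bin !big_split /= !prodfV !big_split /=.
rewrite [in RHS]big_ltn// [in X in _ = _ / (_ * X)]big_ltn//= !mul1r.
rewrite !big_add1 /=.
rewrite [X in _ = _ / (X * _)]big_nat_recr//=.
rewrite (_ : ent u k N.+1 = 0%N) ?sub0n ?phi0 ?mulr1//.
by rewrite ent_out// /site; lia.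
Qed.

Lemma prod_local (s : seq nat) (F G : nat -> R) (c d : R) :
  uniq s -> all (fun i => (0 < i < N.+2)%N) s ->
  (forall i, i \notin s -> F i = G i) ->
  c * \prod_(i <- s) F i = d * \prod_(i <- s) G i ->
  c * \prod_(1 <= i < N.+2) F i = d * \prod_(1 <= i < N.+2) G i.
Proof.
move=> us /allP ss FG E.
have split (H : nat -> R) : \prod_(1 <= i < N.+2) H i =
    \prod_(i <- s) H i * \prod_(1 <= i < N.+2 | i \notin s) H i.
  rewrite (bigID (mem s))/=; congr (_ * _); rewrite -big_filter.
  apply: perm_big; apply: uniq_perm => //; first by rewrite filter_uniq// iota_uniq.
  move=> i; rewrite mem_filter mem_index_iota; case: (boolP (i \in s)) => //= /ss; lia.
rewrite !split !mulrA E; congr (_ * _); apply: eq_bigr => i; exact: FG.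
Qed.

Lemma below_xent x k j : (0 < k <= N)%N -> (0 < j)%N -> forall v,
  (v < ent (val x) k j)%N ->
  below v (xent (val x) k.-1 j.-1) && below v (xent (val x) k j.-1).
Proof.
move=> kN j0 v vx; case: j j0 vx => [//|[//|j]] _.
have := ent_le x kN (j := j.+1) isT; have := ent_le x kN (j := j.+2) isT.
by move: (val x) => u /=; lia.
Qed.

Section Steps.
Variables (x y : pattern N) (k : nat).
Hypothesis kN : (0 < k <= N)%N.

Let A0 : abar a k != 0. Proof. by rewrite gt_eqF// abar_gt0. Qed.

Let tile_eq i : ent (val x) k i = ent (val y) k i ->
  ent (val x) k.-1 i = ent (val y) k.-1 i ->
  ent (val x) k i.-1 = ent (val y) k i.-1 ->
  ent (val x) k.-1 i.-1 = ent (val y) k.-1 i.-1 -> tile (val x) k i = tile (val y) k i.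
Proof.
move=> e1 e2 /(@xent_eq N (val x)) e3 /(@xent_eq N (val x)) e4.
by rewrite /tile e1 e2 e3 e4.
Qed.

(** First level of a cascade to the right: the interaction with the level below
    disappears from the rate, and a factor that depends on level [k] alone
    remains. *)
Lemma Lambda_right_start j : (0 < j <= N)%N ->
  (forall i, ent (val y) k.-1 i = ent (val x) k.-1 i) ->
  (forall i, ent (val y) k i = (ent (val x) k i + (i == j))%N) ->
  abar a k * rate_right q (val x) k j * Lam x k =
  gap_rate (xent (val x) k j.-1) (ent (val x) k j) * Lam y k.
Proof.
move=> /andP[j0 jN] Eb Ea; rewrite !LambdaE//.
apply: (prod_local (s := [:: j; j.+1])).
- by rewrite /= inE andbT; lia.
- by rewrite /=; lia.
- move=> i; rewrite !inE => ij.
  by apply: tile_eq; rewrite ?Ea ?Eb//; lia.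
rewrite !big_cons !big_nil !mulr1 /tile /rate_right.
have b1 : xent (val y) k.-1 j.-1 = xent (val x) k.-1 j.-1 by apply: xent_eq.
have b2 : xent (val y) k j.-1 = xent (val x) k j.-1 by apply: xent_eq; rewrite Ea; lia.
have /andP[] := @below_xent y k j kN j0 (ent (val x) k j) ltac:(rewrite Ea; lia).
rewrite b1 b2.
have := @ent_le N x k j kN j0.
rewrite !(@xent_succ _ _ _ j)// !Eb.
have -> : ent (val y) k j = (ent (val x) k j).+1 by rewrite Ea; lia.
have -> : ent (val y) k j.+1 = ent (val x) k j.+1 by rewrite Ea; lia.
move: A0.
move: (abar a k) (xent (val x) k j.-1) (xent (val x) k.-1 j.-1) => A o o'.
move: (ent (val x) k j) (ent (val x) k.-1 j) => u v.
move: (ent (val x) k j.+1) (ent (val x) k.-1 j.+1) => u1 v1.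
move=> A0' /andP[h1 h2] bo' bo /=.
rewrite -/(gap_rate o' u) !subSn; [|lia|lia].
rewrite !phiS (phio_gapS bo) (phio_gapS bo') (exprSr A) !addn1.
have nz := (phi_neq0, phio_neq0, gap_rate_neq0 bo, gap_rate_neq0 bo', expf_neq0, A0', onem_neq0).
by field; rewrite !nz.
Qed.

(** A level at which the cascade to the right pushes a particle: the factor left
    by the level below is exchanged for the same expression one level higher. *)
Lemma Lambda_right_push j : (0 < j <= N)%N ->
  (forall i, ent (val y) k.-1 i = (ent (val x) k.-1 i + (i == j))%N) ->
  (forall i, ent (val y) k i = (ent (val x) k i + (i == j))%N) ->
  ent (val x) k j = ent (val x) k.-1 j ->
  gap_rate (xent (val x) k.-1 j.-1) (ent (val x) k.-1 j) * Lam x k =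
  gap_rate (xent (val x) k j.-1) (ent (val x) k j) * Lam y k.
Proof.
move=> /andP[j0 jN] Eb Ea ab; rewrite !LambdaE//.
apply: (prod_local (s := [:: j; j.+1])).
- by rewrite /= inE andbT; lia.
- by rewrite /=; lia.
- move=> i; rewrite !inE => ij.
  by apply: tile_eq; rewrite ?Ea ?Eb//; lia.
rewrite !big_cons !big_nil !mulr1 /tile.
have b1 : xent (val y) k.-1 j.-1 = xent (val x) k.-1 j.-1 by apply: xent_eq; rewrite Eb; lia.
have b2 : xent (val y) k j.-1 = xent (val x) k j.-1 by apply: xent_eq; rewrite Ea; lia.
have /andP[] := @below_xent y k j kN j0 (ent (val x) k j) ltac:(rewrite Ea; lia).
rewrite b1 b2.
have := @ent_le N x k j kN j0.
rewrite !(@xent_succ _ _ _ j)//.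
have -> : ent (val y) k j = (ent (val x) k j).+1 by rewrite Ea; lia.
have -> : ent (val y) k j.+1 = ent (val x) k j.+1 by rewrite Ea; lia.
have -> : ent (val y) k.-1 j = (ent (val x) k.-1 j).+1 by rewrite Eb; lia.
have -> : ent (val y) k.-1 j.+1 = ent (val x) k.-1 j.+1 by rewrite Eb; lia.
rewrite -ab; move: A0.
move: (abar a k) (xent (val x) k j.-1) (xent (val x) k.-1 j.-1) => A o o'.
move: (ent (val x) k j) => u.
move: (ent (val x) k j.+1) (ent (val x) k.-1 j.+1) => u1 v1.
move=> A0' /andP[h1 _] bo' bo /=.
rewrite !subSS !subnn !subSn; [|lia].
rewrite !phiS (phio_gapS bo) (phio_gapS bo') (exprSr A) phi0.
have nz := (phi_neq0, phio_neq0, gap_rate_neq0 bo, gap_rate_neq0 bo', expf_neq0, A0', onem_neq0).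
by field; rewrite !nz.
Qed.

(** The level above the end of a cascade to the right: there only the lower of
    the two rows of [Lambda] has changed. *)
Lemma Lambda_right_end j : (0 < j <= N)%N ->
  (forall i, ent (val y) k.-1 i = (ent (val x) k.-1 i + (i == j))%N) ->
  (forall i, ent (val y) k i = ent (val x) k i) ->
  (1 - q ^+ (ent (val y) k j - ent (val y) k.-1 j + 1)) * Lam x k =
  (abar a k * (1 - q ^+ (ent (val y) k.-1 j - ent (val y) k j.+1))) * Lam y k.
Proof.
move=> /andP[j0 jN] Eb Ea; rewrite !LambdaE//.
apply: (prod_local (s := [:: j; j.+1])).
- by rewrite /= inE andbT; lia.
- by rewrite /=; lia.
- move=> i; rewrite !inE => ij.
  by apply: tile_eq; rewrite ?Ea ?Eb//; lia.
rewrite !big_cons !big_nil !mulr1 /tile.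
have b1 : xent (val y) k.-1 j.-1 = xent (val x) k.-1 j.-1 by apply: xent_eq; rewrite Eb; lia.
have b2 : xent (val y) k j.-1 = xent (val x) k j.-1 by apply: xent_eq; rewrite Ea; lia.
rewrite b1 b2.
have := @ent_le N x k j kN j0; have := @ent_le N y k j kN j0.
rewrite !(@xent_succ _ _ _ j)// !Ea.
have -> : ent (val y) k.-1 j = (ent (val x) k.-1 j).+1 by rewrite Eb; lia.
have -> : ent (val y) k.-1 j.+1 = ent (val x) k.-1 j.+1 by rewrite Eb; lia.
move: A0.
move: (abar a k) (xent (val x) k j.-1) (xent (val x) k.-1 j.-1) => A o o'.
move: (ent (val x) k j) (ent (val x) k.-1 j) => u v.
move: (ent (val x) k j.+1) (ent (val x) k.-1 j.+1) => u1 v1.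
move=> A0' /andP[_ h1] /andP[h2 _] /=.
rewrite addn1 !subnSK// (subSn h2) -{2}(subnSK h1) !phiS !subnSK// (exprSr A).
have nz : 1 - q ^+ (u - v) != 0 by rewrite -subnSK// onem_neq0.
have nzs := (phi_neq0, phio_neq0, expf_neq0, A0', onem_neq0, nz).
by field; rewrite !nzs.
Qed.

Lemma Lambda_left_start j : (0 < j <= N)%N ->
  (forall i, ent (val x) k.-1 i = ent (val y) k.-1 i) ->
  (forall i, ent (val x) k i = (ent (val y) k i + (i == j))%N) ->
  (abar a k)^-1 * rate_left q (val x) k j * Lam x k =
  (1 - q ^+ (ent (val x) k j - ent (val x) k j.+1)) * Lam y k.
Proof.
move=> /andP[j0 jN] Eb Ea; rewrite !LambdaE//.
apply: (prod_local (s := [:: j; j.+1])).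
- by rewrite /= inE andbT; lia.
- by rewrite /=; lia.
- move=> i; rewrite !inE => ij.
  by apply: tile_eq; rewrite ?Ea ?Eb//; lia.
rewrite !big_cons !big_nil !mulr1 /tile /rate_left.
have b1 : xent (val x) k.-1 j.-1 = xent (val y) k.-1 j.-1 by apply: xent_eq.
have b2 : xent (val x) k j.-1 = xent (val y) k j.-1 by apply: xent_eq; rewrite Ea; lia.
have /andP[] := @below_xent x k j kN j0 (ent (val y) k j) ltac:(rewrite Ea; lia).
rewrite b1 b2.
have := @ent_le N y k j kN j0.
rewrite !(@xent_succ _ _ _ j)// !Eb.
have -> : ent (val x) k j = (ent (val y) k j).+1 by rewrite Ea; lia.
have -> : ent (val x) k j.+1 = ent (val y) k j.+1 by rewrite Ea; lia.
move: A0.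
move: (abar a k) (xent (val y) k j.-1) (xent (val y) k.-1 j.-1) => A o o'.
move: (ent (val y) k j) (ent (val y) k.-1 j) => u v.
move: (ent (val y) k j.+1) (ent (val y) k.-1 j.+1) => u1 v1.
move=> A0' /andP[h1 h2] bo' bo /=.
rewrite !succ_gap// -/(gap_rate o u) -/(gap_rate o' u) !subSn; [|lia|lia].
rewrite !phiS (phio_gapS bo) (phio_gapS bo') (exprSr A).
have nz := (phi_neq0, phio_neq0, gap_rate_neq0 bo, gap_rate_neq0 bo', expf_neq0, A0', onem_neq0).
by field; rewrite !nz.
Qed.

Lemma Lambda_left_push j : (0 < j < N)%N ->
  (forall i, ent (val x) k.-1 i = (ent (val y) k.-1 i + (i == j))%N) ->
  (forall i, ent (val x) k i = (ent (val y) k i + (i == j.+1))%N) ->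
  ent (val x) k j.+1 = ent (val x) k.-1 j ->
  (1 - q ^+ (ent (val x) k.-1 j - ent (val x) k.-1 j.+1)) * Lam x k =
  (1 - q ^+ (ent (val x) k j.+1 - ent (val x) k j.+2)) * Lam y k.
Proof.
move=> /andP[j0 jN] Eb Ea ab; rewrite !LambdaE//.
apply: (prod_local (s := [:: j; j.+1; j.+2])).
- by rewrite /= !inE andbT; lia.
- by rewrite /=; lia.
- move=> i; rewrite !inE => ij.
  by apply: tile_eq; rewrite ?Ea ?Eb//; lia.
rewrite !big_cons !big_nil !mulr1 /tile.
have b1 : xent (val x) k.-1 j.-1 = xent (val y) k.-1 j.-1 by apply: xent_eq; rewrite Eb; lia.
have b2 : xent (val x) k j.-1 = xent (val y) k j.-1 by apply: xent_eq; rewrite Ea; lia.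
rewrite b1 b2.
have := @ent_le N y k j kN j0; have := @ent_le N x k j kN j0.
have := @ent_le N y k j.+1 kN isT.
rewrite !(@xent_succ _ _ _ j)// !(@xent_succ _ _ _ j.+1)//.
have ex : ent (val x) k.-1 j = (ent (val y) k.-1 j).+1 by rewrite Eb; lia.
have ey : ent (val y) k j.+1 = ent (val y) k.-1 j.
  by have := Ea j.+1; rewrite ab ex; lia.
rewrite ab ex ey.
have -> : ent (val x) k.-1 j.+1 = ent (val y) k.-1 j.+1 by rewrite Eb; lia.
have -> : ent (val x) k.-1 j.+2 = ent (val y) k.-1 j.+2 by rewrite Eb; lia.
have -> : ent (val x) k j = ent (val y) k j by rewrite Ea; lia.
have -> : ent (val x) k j.+2 = ent (val y) k j.+2 by rewrite Ea; lia.
move: A0.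
move: (abar a k) (xent (val y) k j.-1) (xent (val y) k.-1 j.-1) => A o o'.
move: (ent (val y) k j) (ent (val y) k.-1 j) => w u.
move: (ent (val y) k.-1 j.+1) (ent (val y) k j.+2) (ent (val y) k.-1 j.+2) => v1 u2 v2.
move=> A0' /andP[h1 h2] /andP[_ h3] _ /=.
rewrite !subSS !subnn phi0 !subSn//; [|lia].
rewrite -(subnSK h3) !phiS (exprSr A).
have nzs := (phi_neq0, phio_neq0, expf_neq0, A0', onem_neq0).
by field; rewrite !nzs.
Qed.

Lemma Lambda_left_end j : (0 < j <= N)%N ->
  (forall i, ent (val x) k.-1 i = (ent (val y) k.-1 i + (i == j))%N) ->
  (forall i, ent (val x) k i = ent (val y) k i) ->
  (1 - q ^+ (ent (val y) k.-1 j - ent (val y) k j.+1 + 1)) * Lam x k =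
  ((abar a k)^-1 * (1 - q ^+ (ent (val y) k j - ent (val y) k.-1 j))) * Lam y k.
Proof.
move=> /andP[j0 jN] Eb Ea; rewrite !LambdaE//.
apply: (prod_local (s := [:: j; j.+1])).
- by rewrite /= inE andbT; lia.
- by rewrite /=; lia.
- move=> i; rewrite !inE => ij.
  by apply: tile_eq; rewrite ?Ea ?Eb//; lia.
rewrite !big_cons !big_nil !mulr1 /tile.
have b1 : xent (val x) k.-1 j.-1 = xent (val y) k.-1 j.-1 by apply: xent_eq; rewrite Eb; lia.
have b2 : xent (val x) k j.-1 = xent (val y) k j.-1 by apply: xent_eq; rewrite Ea; lia.
rewrite b1 b2.
have := @ent_le N y k j kN j0; have := @ent_le N x k j kN j0.
rewrite !(@xent_succ _ _ _ j)// !Ea.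
have -> : ent (val x) k.-1 j = (ent (val y) k.-1 j).+1 by rewrite Eb; lia.
have -> : ent (val x) k.-1 j.+1 = ent (val y) k.-1 j.+1 by rewrite Eb; lia.
move: A0.
move: (abar a k) (xent (val y) k j.-1) (xent (val y) k.-1 j.-1) => A o o'.
move: (ent (val y) k j) (ent (val y) k.-1 j) => u v.
move: (ent (val y) k j.+1) (ent (val y) k.-1 j.+1) => u1 v1.
move=> A0' /andP[_ h1] /andP[h2 _] /=.
rewrite addn1 (subSn h2) -(subnSK h1) !phiS (exprSr A).
have nzs := (phi_neq0, phio_neq0, expf_neq0, A0', onem_neq0).
by field; rewrite !nzs.
Qed.

End Steps.

Lemma Lambda_eq x y k : (0 < k <= N)%N ->
  (forall l i, (l == k) || (l == k.-1) -> ent (val x) l i = ent (val y) l i) ->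
  Lam x k = Lam y k.
Proof.
move=> kN E; rewrite !LambdaE//; apply: eq_bigr => i _.
have E1 i' : ent (val x) k i' = ent (val y) k i' by apply: E; rewrite eqxx.
have E2 i' : ent (val x) k.-1 i' = ent (val y) k.-1 i' by apply: E; rewrite eqxx orbT.
by rewrite /tile !E1 !E2 (xent_eq (E1 _)) (xent_eq (E2 _)).
Qed.

Lemma tile_gt0 x k i : (0 < k <= N)%N -> 0 < tile (val x) k i.
Proof.
move=> kN; have A0 := abar_gt0 kN.
have P0 o : 0 < phio o by case: o => //= m; exact: phi_gt0.
by rewrite /tile !(mulr_gt0, invr_gt0, exprn_gt0, phi_gt0, P0).
Qed.

Lemma weight_gt0 x : 0 < weight q a x.
Proof.
rewrite /weight big_nat; apply: prodr_gt0 => k kN.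
rewrite LambdaE; last lia.
by apply: prodr_gt0 => i _; apply: tile_gt0; lia.
Qed.

Let lower_weight x m : R := \prod_(1 <= k < m.+1) Lam x k.

Let lower_weightS x m : lower_weight x m.+1 = lower_weight x m * Lam x m.+1.
Proof. by rewrite /lower_weight big_nat_recr. Qed.

Let weight_above x y m : (m <= N)%N ->
  (forall l i, (m <= l)%N -> ent (val x) l i = ent (val y) l i) ->
  forall c d, c * lower_weight x m = d * lower_weight y m ->
  c * weight q a x = d * weight q a y.
Proof.
move=> mN E c d; rewrite /weight /lower_weight.
rewrite !(big_cat_nat (m := 1) (n := m.+1) (p := N.+1))//= !mulrA => ->; congr (_ * _).
rewrite big_nat_cond [RHS]big_nat_cond; apply: eq_bigr => k hk.
by apply: Lambda_eq => [|l i lk]; [lia|apply: E; lia].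
Qed.

Let lower_weight_below x y m : (m <= N)%N ->
  (forall l i, (l <= m)%N -> ent (val x) l i = ent (val y) l i) ->
  lower_weight x m = lower_weight y m.
Proof.
move=> mN E; rewrite /lower_weight big_nat_cond [RHS]big_nat_cond.
apply: eq_bigr => k hk.
by apply: Lambda_eq => [|l i lk]; [lia|apply: E; lia].
Qed.

Let end_factor (A g h D w s t : R) : D != 0 ->
  D * s = A * h * t -> g * w * s = A * (g * h / D) * (w * t).
Proof.
move=> D0 E; apply: (mulfI D0).
rewrite (_ : D * (g * w * s) = g * w * (D * s)); last by ring.
by rewrite E; field.
Qed.

(** The rate, for the dynamics reversed with respect to the weight, at which [u] is
    left by undoing a cascade to the right that stopped at place [j] of level
    [m]. It involves the levels [m] and [m + 1] only, wherever the cascade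
    started. *)
Definition right_flux (u : array N) m j : R :=
  let g := 1 - qpow q (omap succn (gap (xent u m j.-1) (ent u m j))) in
  if (m < N)%N then
    abar a m.+1 * (g * (1 - q ^+ (ent u m j - ent u m.+1 j.+1)) /
                   (1 - q ^+ (ent u m.+1 j - ent u m j + 1)))
  else g.

Definition left_flux (u : array N) m j : R :=
  let g := 1 - q ^+ (ent u m j - ent u m j.+1 + 1) in
  if (m < N)%N then
    (abar a m.+1)^-1 * (g * (1 - q ^+ (ent u m.+1 j - ent u m j)) /
                        (1 - q ^+ (ent u m j - ent u m.+1 j.+1 + 1)))
  else g.

(** Climbing the cascade, the telescoping product of [Lambda_right_start] and
    [Lambda_right_push] leaves the factor of the last level, which
    [Lambda_right_end] completes. *)
Lemma right_weight x y (p e : particle N) :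
  right_source (val y) (level p) (level e) (place e) -> place p = place e ->
  val x = lower (col_path (level p) (level e) (place e)) (val y) ->
  rate_r q a (val x) p * weight q a x =
  right_flux (val y) (level e) (place e) * weight q a y.
Proof.
move=> [km const low] pe xE; rewrite /rate_r pe.
have := site_particle e; move: (level p) (level e) (place e) km const low xE.
move=> k m j km const low xE /andP[/andP[m0 mN] /andP[j0 jm]].
have jN : (j <= N)%N by lia.
have yE l i : ent (val y) l i = (ent (val x) l i + col_path k m j l i)%N.
  rewrite xE ent_lower /col_path; case: (i =P j) => [->|ij]; last by rewrite andbF; lia.
  by case: (boolP (k <= l <= m)%N) => kl; [rewrite const//; lia|lia].
pose rate := abar a k * rate_right q (val x) k j.
have climb d : (k + d <= m)%N -> rate * lower_weight x (k + d) =
    gap_rate (xent (val x) (k + d) j.-1) (ent (val x) (k + d) j) * lower_weight y (k + d).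
  elim: d => [|d IH] kd.
    rewrite addn0; have [k' ek] : exists k', k = k'.+1 by exists k.-1; lia.
    rewrite ek !lower_weightS -ek.
    rewrite (@lower_weight_below x y); [|lia|]; last first.
      by move=> l i lk; rewrite yE /col_path; lia.
    rewrite mulrCA [RHS]mulrCA; congr (_ * _); rewrite /rate.
    by apply: Lambda_right_start; [lia|lia| |]; move=> i; rewrite yE /col_path; lia.
  rewrite addnS !lower_weightS mulrA IH; last lia.
  rewrite mulrAC [RHS]mulrCA mulrC; congr (_ * _).
  apply: (@Lambda_right_push x y (k + d).+1); [lia|lia| | |].
  - by move=> i; rewrite yE /col_path; lia.
  - by move=> i; rewrite yE /col_path; lia.
  - have := const (k + d)%N ltac:(lia); have := const (k + d).+1 ltac:(lia).
    by rewrite -[(k + d).+1.-1]/(k + d)%N !yE /col_path; lia.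
have := climb (m - k)%N ltac:(lia); rewrite subnKC; last lia.
have eym : ent (val y) m j = (ent (val x) m j).+1 by rewrite yE /col_path; lia.
have -> : xent (val x) m j.-1 = xent (val y) m j.-1.
  by apply: xent_eq; rewrite yE /col_path; lia.
have /andP[_ bo] := @below_xent y m j ltac:(lia) j0 (ent (val x) m j) ltac:(lia).
rewrite /right_flux; case: ifP => mlt; last first.
  have em : m = N by lia.
  by subst m; rewrite eym succ_gap.
move=> E; apply: (@weight_above _ _ m.+1) => //.
  by move=> l i ml; rewrite yE /col_path; lia.
rewrite !lower_weightS mulrA E eym succ_gap// -/(gap_rate _ _).
have := @Lambda_right_end x y m.+1 ltac:(lia) j ltac:(lia).
move=> /(_ ltac:(by move=> i; rewrite yE /col_path; lia)).
move=> /(_ ltac:(by move=> i; rewrite yE /col_path; lia)).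
rewrite eym addn1.
exact/end_factor/onem_neq0.
Qed.

Lemma left_weight x y (p e : particle N) :
  left_source (val y) (level p) (place p) (level e) (place e) ->
  val x = raise (diag_path (level p) (level e) (place p)) (val y) ->
  rate_l q a (val x) p * weight q a x =
  left_flux (val y) (level e) (place e) * weight q a y.
Proof.
move=> [[km skj] ij const high] xE; rewrite /rate_l.
have := site_particle e; move: (level p) (place p) (level e) (place e) km skj ij const high xE.
move=> k j m i km skj ij const high xE /andP[/andP[m0 mN] /andP[i0 im]].
have /andP[_ /andP[j0 jk]] := skj.
have iN : (i <= N)%N by lia.
have sm : @site N m i by rewrite /site; lia.
have st l i' : diag_path k m j l i' -> @site N l i'.
  by move: skj sm; rewrite /site /diag_path; lia.
have yE l i' : ent (val x) l i' = (ent (val y) l i' + diag_path k m j l i')%N.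
  rewrite xE; have [s|ns] := boolP (@site N l i'); first by rewrite ent_raise.
  by rewrite !(ent_out _ ns); case: (boolP (diag_path _ _ _ _ _)) => // /st; rewrite (negbTE ns).
pose rate := (abar a k)^-1 * rate_left q (val x) k j.
have climb d : (k + d <= m)%N -> rate * lower_weight x (k + d) =
    (1 - q ^+ (ent (val x) (k + d) (j + d) - ent (val x) (k + d) (j + d).+1)) *
    lower_weight y (k + d).
  elim: d => [|d IH] kd.
    rewrite !addn0; have [k' ek] : exists k', k = k'.+1 by exists k.-1; lia.
    rewrite ek !lower_weightS -ek.
    rewrite (@lower_weight_below x y); [|lia|]; last first.
      by move=> l i' lk; rewrite yE /diag_path; lia.
    rewrite mulrCA [RHS]mulrCA; congr (_ * _); rewrite /rate.
    by apply: Lambda_left_start; [lia|lia| |]; move=> i'; rewrite yE /diag_path; lia.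
  rewrite !addnS !lower_weightS mulrA IH; last lia.
  rewrite mulrAC [RHS]mulrCA mulrC; congr (_ * _).
  apply: (@Lambda_left_push x y (k + d).+1); [lia|lia| | |].
  - by move=> i'; rewrite yE /diag_path; lia.
  - by move=> i'; rewrite yE /diag_path; lia.
  - have := const (k + d)%N ltac:(lia); have := const (k + d).+1 ltac:(lia).
    rewrite (_ : j + (k + d) - k = j + d)%N; last lia.
    rewrite (_ : j + (k + d).+1 - k = (j + d).+1)%N; last lia.
    by rewrite -[(k + d).+1.-1]/(k + d)%N !yE /diag_path; lia.
have := climb (m - k)%N ltac:(lia); rewrite subnKC; last lia.
rewrite (_ : j + (m - k) = i)%N; last lia.
have exm : ent (val x) m i = (ent (val y) m i).+1 by rewrite yE /diag_path; lia.
have -> : ent (val x) m i.+1 = ent (val y) m i.+1 by rewrite yE /diag_path; lia.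
have le : (ent (val y) m i.+1 <= ent (val y) m i)%N.
  by have /andP[h1 h2] := @ent_le N y m i ltac:(lia) i0; lia.
rewrite /left_flux exm subSn// addn1; case: ifP => mlt; last first.
  have em : m = N by lia.
  by subst m.
move=> E; apply: (@weight_above _ _ m.+1) => //.
  by move=> l i' ml; rewrite yE /diag_path; lia.
rewrite !lower_weightS mulrA E.
have := @Lambda_left_end x y m.+1 ltac:(lia) i ltac:(lia).
move=> /(_ ltac:(by move=> i'; rewrite yE /diag_path; lia)).
move=> /(_ ltac:(by move=> i'; rewrite yE /diag_path; lia)).
rewrite addn1.
exact/end_factor/onem_neq0.
Qed.

End Weights.

(** * Top rows and their fibres *)

Section TopRow.
Context {n N : nat}.
Hypothesis n_gt0 : (0 < n)%N.
Hypothesis hn : N.+1./2 = n.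
Implicit Types (x y : pattern N) (k l m j i v : nat) (z : cone n) (p e : particle N).

Local Notation top := (top_row n).

Lemma part_top x i : part (top x) i.+1 = ent (val x) N i.+1.
Proof.
rewrite /part -[i.+1.-1]/i; have [i_n|n_i] := ltnP i n.
  by rewrite -[i in LHS]/(nat_of_ord (Ordinal i_n)) -tnth_nth tnth_mktuple.
rewrite nth_default ?size_tuple// ent_out// /site; lia.
Qed.

Lemma part_out z i : (n <= i)%N -> part z i.+1 = 0%N.
Proof. by move=> ni; rewrite /part nth_default// size_tuple. Qed.

Lemma part_sorted z i : (part z i.+2 <= part z i.+1)%N.
Proof.
have [ni|i_n] := leqP n i.+1; first by rewrite part_out.
by case: z => z sz; rewrite /part /=; apply: (sortedP 0%N sz); rewrite size_tuple.
Qed.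

Lemma cone_eqP z z' : (forall i, part z i.+1 = part z' i.+1) -> z = z'.
Proof.
move=> E; apply: val_inj; apply: eq_from_tnth => i.
by have := E i; rewrite /part /= -!tnth_nth.
Qed.

Lemma top_eqP x z : reflect (forall i, ent (val x) N i.+1 = part z i.+1) (top x == z).
Proof.
apply: (iffP eqP) => [<- i|E]; first by rewrite part_top.
by apply: cone_eqP => i; rewrite part_top.
Qed.

Lemma raisedP (i : 'I_n) z z' : reflect
  (forall l, part z' l.+1 = (part z l.+1 + (l == i))%N) (raised i z z').
Proof.
apply: (iffP forallP) => [E l|E l].
  have [ln|nl] := ltnP l n.
    by have /eqP := E (Ordinal ln); rewrite !(tnth_nth 0%N).
  by rewrite !part_out//; have := ltn_ord i; lia.
by rewrite !(tnth_nth 0%N) -[l == i]/(val l == val i); apply/eqP/E.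
Qed.

Lemma ent_bounded x k j : (ent (val x) k j <= part (top x) 1)%N.
Proof.
have [s|ns] := boolP (@site N k j); last by rewrite ent_out.
have /andP[/andP[k0 kN] /andP[j0 jk]] := s.
apply: leq_trans (ent_column_mono x (k := k) (l := N) j0 ltac:(lia)) _.
rewrite part_top; case: j j0 {s jk} => // j _; elim: j => // j IH.
exact: leq_trans (top_decreasing x j) IH.
Qed.

(** The patterns with a given top row, listed through the finitely many arrays
    whose entries do not exceed the first part of that row. *)
Definition fiber z : seq (pattern N) :=
  undup [seq x <- pmap insub [seq [ffun p => nat_of_ord (g p)] |
     g : {ffun particle N -> 'I_(part z 1).+1} ] | top x == z].

Lemma uniq_fiber z : uniq (fiber z). Proof. exact: undup_uniq. Qed.

Lemma mem_fiber z x : (x \in fiber z) = (top x == z).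
Proof.
rewrite mem_undup mem_filter; case: eqP => //= xz.
rewrite mem_pmap; apply/mapP; exists (val x); last by rewrite valK.
apply/mapP; exists [ffun p => inord (val x p)]; first by rewrite mem_enum.
apply/ffunP => p; rewrite !ffunE inordK//.
by rewrite ltnS -xz -ent_particle ent_bounded.
Qed.

(** Repeating the top row on all levels gives a pattern. *)
Lemma fiber_neq0 z : exists x, top x = z.
Proof.
pose u : array N := [ffun p => part z (place p)].
have uE k j : @site N k j -> ent u k j = part z j.
  move=> s; rewrite -[RHS](@entE N (fun _ j _ => part z j) u k j s).
  by congr ent; apply/ffunP => p; rewrite !ffunE.
have iu : interlacing u.
  apply/interlacingP => k j kN j0.
  have [s|ns] := boolP (@site N k j); last first.
    rewrite (ent_out _ ns) leq0n andbT ent_out//.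
    by move: ns; rewrite /site; lia.
  have s2 : @site N k.+1 j by move: s; rewrite /site; lia.
  rewrite (uE _ _ s) (uE _ _ s2) leqnn andbT.
  have [s3|ns] := boolP (@site N k.+1 j.+1); last by rewrite ent_out.
  by rewrite uE//; case: j j0 {s s2 s3} => // j _; exact: part_sorted.
exists (exist (fun u => interlacing u) u iu); apply/eqP/top_eqP => i.
have [i_n|n_i] := ltnP i n; last by rewrite part_out// ent_out// /site; lia.
by rewrite uE// /site; lia.
Qed.

(** * The generator and the weights *)

Section Generator.
Context {R : realType} (q : R) (a : n.-tuple R).
Hypothesis q_gt0 : 0 < q.
Hypothesis q_lt1 : q < 1.
Hypothesis a_gt0 : forall i : 'I_n, 0 < tnth a i.

Let N_le : (N <= n.*2)%N. Proof. lia. Qed.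
Let N_gt0 : (0 < N)%N. Proof. lia. Qed.

Lemma PhatE z : Phat N q a z = \sum_(x <- fiber z) weight q a x.
Proof.
rewrite /Phat (_ : [set x | top x = z] = [set` fiber z]) -?fsbig_seq ?uniq_fiber//.
by apply/seteqP; split=> x /=; rewrite mem_fiber => /eqP.
Qed.

Lemma Phat_gt0 z : 0 < Phat N q a z.
Proof.
have [x xz] := fiber_neq0 z.
rewrite PhatE (bigD1_seq x) ?uniq_fiber ?mem_fiber ?xz//=.
rewrite ltr_pwDl//; first exact: weight_gt0.
by apply: sumr_ge0 => y _; apply/ltW/weight_gt0.
Qed.

Lemma gibbs_ge0 z x : 0 <= gibbs q a z x.
Proof.
rewrite /gibbs; case: ifP => // _; rewrite divr_ge0 ?ltW ?Phat_gt0//.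
exact: weight_gt0.
Qed.

Lemma gibbs_off z x : top x != z -> gibbs q a z x = 0.
Proof. by rewrite /gibbs => /negbTE ->. Qed.

Lemma gibbs_sum z : \sum_(x <- fiber z) gibbs q a z x = 1.
Proof.
rewrite big_seq (eq_bigr (fun x => weight q a x / Phat N q a z)) => [|x]; last first.
  by rewrite mem_fiber /gibbs => ->.
by rewrite -big_seq -mulr_suml -PhatE divff// gt_eqF// Phat_gt0.
Qed.

Lemma free_right_rate x p : ~~ free_right (val x) (level p) (place p) ->
  rate_r q a (val x) p = 0.
Proof.
rewrite /free_right negb_or -leqNgt /rate_r /rate_right => /andP[j1 le].
have /andP[_ /andP[j0 _]] := site_particle p.
have -> : xent (val x) (level p).-1 (place p).-1 =
    Some (ent (val x) (level p).-1 (place p).-1).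
  by case: (place p) j0 j1 => [|[|j]].
by rewrite /= (eqP (_ : (_ - _ == 0)%N)) ?subn_eq0// expr0 subrr mul0r mulr0.
Qed.

Lemma free_left_rate x p : ~~ free_left (val x) (level p) (place p) ->
  rate_l q a (val x) p = 0.
Proof.
rewrite /free_left -leqNgt /rate_l /rate_left => le.
by rewrite (eqP (_ : (_ - _ == 0)%N)) ?subn_eq0// expr0 subrr mul0r mulr0.
Qed.

Lemma jump_right_neq x p : val x != jump_right (val x) p.
Proof.
have s := site_particle p; have /andP[/andP[k0 kN] _] := s.
have [m [km _ _ h]] := push_rightP (val x) (subnKC kN) s.
rewrite /jump_right h; apply/eqP => /(congr1 (fun u => ent u (level p) (place p))).
by rewrite ent_raise// /col_path; lia.
Qed.

Lemma jump_left_neq x p : free_left (val x) (level p) (place p) ->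
  val x != jump_left (val x) p.
Proof.
rewrite /free_left => fr.
have s := site_particle p; have /andP[/andP[k0 kN] _] := s.
have pos : (0 < ent (val x) (level p) (place p))%N by lia.
have [m [km _ _ h]] := push_leftP (subnKC kN) s pos.
rewrite /jump_left h; apply/eqP => /(congr1 (fun u => ent u (level p) (place p))).
by rewrite ent_lower /diag_path; lia.
Qed.

(** A jump never fixes the configuration when its rate is positive, so the
    two clauses defining the generator merge. *)
Lemma dynamicsE x y : dynamics q a x y = \sum_p
  (rate_r q a (val x) p * ((val y == jump_right (val x) p)%:R - (x == y)%:R) +
   rate_l q a (val x) p * ((val y == jump_left (val x) p)%:R - (x == y)%:R)).
Proof.
rewrite /dynamics; have [<-|_] := eqVneq x y; last first.
  by apply: eq_bigr => p _; rewrite !subr0 !mulr_natr.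
rewrite -sumrN; apply: eq_bigr => p _.
rewrite (negbTE (jump_right_neq x p)).
have [fr|/free_left_rate ->] := boolP (free_left (val x) (level p) (place p)).
  by rewrite (negbTE (jump_left_neq fr)) !mulr0n !mulr1n; ring.
by rewrite !mul0r !mulr0n !mulr1n; ring.
Qed.

Definition successors x : seq (pattern N) :=
  undup (x :: pmap insub ([seq jump_right (val x) p | p : particle N] ++
                          [seq jump_left (val x) p | p : particle N])).

Lemma jump_successor x (u : array N) :
  u \in [seq jump_right (val x) p | p : particle N] ++
        [seq jump_left (val x) p | p : particle N] ->
  interlacing u -> \sum_(y <- successors x) (val y == u)%:R = 1 :> R.
Proof.
move=> mu iu; pose y0 : pattern N := exist (fun u => interlacing u) u iu.
rewrite (bigD1_seq y0) ?undup_uniq//=; last first.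
  rewrite mem_undup inE mem_pmap; apply/orP; right; apply/mapP; exists u => //.
  by rewrite -[u]/(val y0) valK.
rewrite eqxx big1 ?addr0// => y yy0.
by case: eqP => // E; case/eqP: yy0; apply: val_inj.
Qed.

Lemma dynamics_off x y : y \notin successors x -> dynamics q a x y = 0.
Proof.
rewrite mem_undup inE mem_pmap negb_or => /andP[yx yj].
rewrite dynamicsE big1// => p _.
have nj u : u \in [seq jump_right (val x) p | p : particle N] ++
        [seq jump_left (val x) p | p : particle N] -> (val y == u) = false.
  move=> mu; apply: contraNF yj => /eqP yu; apply/mapP; exists u => //.
  by rewrite -yu valK.
rewrite !nj ?mem_cat ?map_f ?mem_enum ?orbT// [x == y]eq_sym (negbTE yx).
by rewrite subrr !mulr0 addr0.
Qed.

(** The rates vanish whenever the resulting array would not be a pattern, so no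
    mass is lost. *)
Lemma dynamics_sum x : \sum_(y <- successors x) dynamics q a x y = 0.
Proof.
under eq_bigr do rewrite dynamicsE.
rewrite exchange_big big1// => p _; rewrite big_split /= -!mulr_sumr !sumrB.
have -> : \sum_(y <- successors x) (x == y)%:R = 1 :> R.
  rewrite (bigD1_seq x) ?undup_uniq ?mem_undup ?mem_head//= eqxx big1 ?addr0//.
  by move=> y; rewrite eq_sym => /negbTE ->.
have mr : jump_right (val x) p \in [seq jump_right (val x) p | p : particle N] ++
    [seq jump_left (val x) p | p : particle N].
  by rewrite mem_cat map_f// mem_enum.
have ml : jump_left (val x) p \in [seq jump_right (val x) p | p : particle N] ++
    [seq jump_left (val x) p | p : particle N].
  by rewrite mem_cat [X in _ || X]map_f ?orbT// mem_enum.
have -> : rate_r q a (val x) p *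
    (\sum_(y <- successors x) (val y == jump_right (val x) p)%:R - 1) = 0.
  have [fr|/free_right_rate ->] := boolP (free_right (val x) (level p) (place p)).
    by rewrite (jump_successor mr) ?subrr ?mulr0//; exact: jump_right_interlacing.
  by rewrite mul0r.
have -> : rate_l q a (val x) p *
    (\sum_(y <- successors x) (val y == jump_left (val x) p)%:R - 1) = 0.
  have [fr|/free_left_rate ->] := boolP (free_left (val x) (level p) (place p)).
    by rewrite (jump_successor ml) ?subrr ?mulr0//; exact: jump_left_interlacing.
  by rewrite mul0r.
by rewrite addr0.
Qed.


Lemma sum_single z x0 p0 (F : pattern N -> particle N -> R) :
  \sum_(x <- fiber z) \sum_p F x p * ((x == x0) && (p == p0))%:R =
  (top x0 == z)%:R * F x0 p0.
Proof.
have inner x : \sum_p F x p * ((x == x0) && (p == p0))%:R = F x p0 * (x == x0)%:R.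
  rewrite (bigD1 p0)//= eqxx andbT big1 ?addr0// => p /negbTE ->.
  by rewrite andbF mulr0.
under eq_bigr do rewrite inner.
have [xz|xz] := boolP (top x0 == z); last first.
  rewrite mul0r big1_seq// => x /andP[_]; rewrite mem_fiber => /eqP xz'.
  case: eqP => [xx|]; last by rewrite mulr0.
  by rewrite -xz' xx eqxx in xz.
rewrite mul1r (bigD1_seq x0) ?uniq_fiber ?mem_fiber//= eqxx mulr1 big1 ?addr0//.
by move=> x /negbTE ->; rewrite mulr0.
Qed.

(** Below the top level the undone cascade does not touch the top row; when the
    source is not a pattern the flux vanishes by itself. *)
Lemma right_sum_lt z y e : (level e < N)%N ->
  \sum_(x <- fiber z) \sum_p (weight q a x * rate_r q a (val x) p) *
     (end_right (val x) p e && (val y == jump_right (val x) p))%:R =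
  (top y == z)%:R * (right_flux q a (val y) (level e) (place e) * weight q a y).
Proof.
move=> eN; have := right_preimage y e; case: ifP => good; last first.
  move=> none; rewrite big1 => [|x _]; last by apply: big1 => p _; rewrite none mulr0.
  rewrite /right_flux eN.
  have -> : (ent (val y) (level e) (place e) - ent (val y) (level e).+1 (place e).+1)%N = 0%N.
    by move: good; rewrite /good_right (minn_idPl eN); lia.
  by rewrite expr0 subrr mulr0 mul0r mulr0 mul0r mulr0.
move=> [p0 [x0 [src pe xE uni]]].
under eq_bigr do under eq_bigr do rewrite uni.
rewrite sum_single; congr (_%:R * _); last first.
  by rewrite mulrC (right_weight q_gt0 q_lt1 a_gt0 N_le src pe xE).
congr (_ == z); apply: cone_eqP => i; rewrite !part_top xE ent_lower /col_path.
lia.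
Qed.

Lemma left_sum_lt z y e : (level e < N)%N ->
  \sum_(x <- fiber z) \sum_p (weight q a x * rate_l q a (val x) p) *
     (end_left (val x) p e && (val y == jump_left (val x) p))%:R =
  (top y == z)%:R * (left_flux q a (val y) (level e) (place e) * weight q a y).
Proof.
move=> eN; have := left_preimage y e; case: ifP => good; last first.
  move=> none; rewrite big1 => [|x _]; last by apply: big1 => p _; rewrite none mulr0.
  rewrite /left_flux eN.
  have -> : (ent (val y) (level e).+1 (place e) - ent (val y) (level e) (place e))%N = 0%N.
    by move: good; rewrite /good_left eN; lia.
  by rewrite expr0 subrr mulr0 mul0r mulr0 mul0r mulr0.
move=> [p0 [x0 [src xE uni]]].
under eq_bigr do under eq_bigr do rewrite uni.
rewrite sum_single; congr (_%:R * _); last first.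
  by rewrite mulrC (left_weight q_gt0 q_lt1 a_gt0 N_le src xE).
congr (_ == z); apply: cone_eqP => i; rewrite !part_top xE.
have [s|ns] := boolP (@site N N i.+1); last by rewrite !(ent_out _ ns).
by rewrite ent_raise// /diag_path; lia.
Qed.

(** On the top level, undoing the cascade lowers one part of the top row, and the
    source is a pattern exactly when the lowered row still belongs to the cone. *)
Lemma right_sum_top z y e (i : 'I_n) : level e = N -> place e = i.+1 ->
  \sum_(x <- fiber z) \sum_p (weight q a x * rate_r q a (val x) p) *
     (end_right (val x) p e && (val y == jump_right (val x) p))%:R =
  ((1 - qpow q (gap (xpart z i) (part z i.+1))) *+ raised i z (top y)) * weight q a y.
Proof.
move=> eN ei; have := right_preimage y e; case: ifP => good; last first.
  move=> none; rewrite big1 => [|x _]; last by apply: big1 => p _; rewrite none mulr0.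
  case: raisedP => [E|_]; last by rewrite !mulr0n !mul0r.
  have := E i; have := E i.+1; have := part_sorted z i.
  by move: good; rewrite !part_top /good_right eN ei (minn_idPr _)//; lia.
move=> [p0 [x0 [src pe xE uni]]].
under eq_bigr do under eq_bigr do rewrite uni.
rewrite sum_single [weight _ _ _ * _]mulrC.
rewrite (right_weight q_gt0 q_lt1 a_gt0 N_le src pe xE) /right_flux eN ltnn ei.
have yE l : ent (val y) N l.+1 = (ent (val x0) N l.+1 + (l == i))%N.
  rewrite xE ent_lower /col_path eN ei; have [km _ _] := src; rewrite eN in km.
  case: (l =P i) => [->|]; last by lia.
  by move: good; rewrite /good_right eN ei; lia.
(* [z] determines whether the source [x0] lies in the fibre that is summed over. *)
have -> : raised i z (top y) = (top x0 == z).
  apply/raisedP/top_eqP => [E l|E l]; last by rewrite part_top yE E.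
  by have := E l; rewrite part_top yE => /addIn.
case: top_eqP => [E|_]; last by rewrite !mulr0n !mul0r.
rewrite mul1r mulr1n; congr ((1 - qpow q _) * _).
have e1 : ent (val y) N i.+1 = (part z i.+1).+1 by rewrite yE E eqxx addn1.
have e2 l : (l < i)%N -> ent (val y) N l.+1 = part z l.+1.
  by move=> li; rewrite yE E (ltn_eqF li) addn0.
rewrite e1; move: (nat_of_ord i) e1 e2 => [//|l] e1 e2.
have := top_decreasing y l; rewrite e1 (e2 l) // => lt.
by rewrite -[l.+2.-1]/(l.+1) /xent /xpart e2//= subnSK.
Qed.

Lemma left_sum_top z y e (i : 'I_n) : level e = N -> place e = i.+1 ->
  \sum_(x <- fiber z) \sum_p (weight q a x * rate_l q a (val x) p) *
     (end_left (val x) p e && (val y == jump_left (val x) p))%:R =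
  ((1 - q ^+ (part z i.+1 - part z i.+2)) *+ raised i (top y) z) * weight q a y.
Proof.
move=> eN ei; have := left_preimage y e; case: ifP => good; last first.
  move=> none; rewrite big1 => [|x _]; last by apply: big1 => p _; rewrite none mulr0.
  case: raisedP => [E|_]; last by rewrite !mulr0n !mul0r.
  move: good; rewrite /good_left eN ltnn ei.
  case: (nat_of_ord i) E => [|j] E //.
  have := E j; have := E j.+1; have := part_sorted z j.
  by rewrite !part_top /=; lia.
move=> [p0 [x0 [src xE uni]]].
under eq_bigr do under eq_bigr do rewrite uni.
rewrite sum_single [weight _ _ _ * _]mulrC.
rewrite (left_weight q_gt0 q_lt1 a_gt0 N_le src xE) /left_flux eN ltnn ei.
have yE l : ent (val x0) N l.+1 = (ent (val y) N l.+1 + (l == i))%N.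
  have [[km _] ij _ _] := src; rewrite eN ei in km ij.
  have [s|ns] := boolP (@site N N l.+1).
    by rewrite xE ent_raise// /diag_path eN; lia.
  rewrite !(ent_out _ ns); have := ltn_ord i.
  by move: ns; rewrite /site; lia.
have -> : raised i (top y) z = (top x0 == z).
  apply/raisedP/top_eqP => [E l|E l]; last by rewrite -E yE part_top.
  by rewrite E part_top yE.
case: top_eqP => [E|_]; last by rewrite !mulr0n !mul0r.
rewrite mul1r mulr1n -!E !yE; congr ((1 - q ^+ _) * _).
by have := top_decreasing y i; lia.
Qed.


Lemma particle_sum (F : nat -> nat -> R) :
  \sum_(p : particle N) F (level p) (place p) =
  \sum_(1 <= k < N.+1) \sum_(1 <= j < k.+1./2.+1) F k j.
Proof.
transitivity (\sum_(p : particle N) \sum_(1 <= k < N.+1) \sum_(1 <= j < k.+1./2.+1)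
    F k j * ((k == level p) && (j == place p))%:R).
  apply: eq_bigr => p _; have /andP[hk hj] := site_particle p.
  rewrite (bigD1_seq (level p)) ?iota_uniq ?mem_index_iota//=.
  rewrite (bigD1_seq (place p)) ?iota_uniq ?mem_index_iota//= !eqxx mulr1.
  rewrite big1 => [|j /negbTE ->]; last by rewrite mulr0.
  rewrite addr0 big1 ?addr0// => k /negbTE ->.
  by apply: big1 => j _; rewrite mulr0.
rewrite exchange_big /= big_nat [RHS]big_nat; apply: eq_bigr => k hk.
rewrite exchange_big /= big_nat [RHS]big_nat; apply: eq_bigr => j hj.
have /siteP[p0 [pk pj]] : @site N k j by rewrite /site; lia.
rewrite (bigD1 p0)//= pk pj !eqxx mulr1 big1 ?addr0// => p pp0.
case: (k =P level p) => [kp|]; last by rewrite mulr0.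
case: (j =P place p) => [jp|]; last by rewrite mulr0.
by case/eqP: pp0; apply: particle_inj; rewrite ?pk ?pj.
Qed.

Lemma top_particle_sum (H : particle N -> R) (F : 'I_n -> R) :
  (forall e (i : 'I_n), level e = N -> place e = i.+1 -> H e = F i) ->
  \sum_(e | ~~ (level e < N)%N) H e = \sum_i F i.
Proof.
move=> HF.
have lt e : ~~ (level e < N)%N -> level e = N /\ exists i : 'I_n, place e = i.+1.
  move=> eN; have := site_particle e; rewrite /site => s.
  have pn : ((place e).-1 < n)%N by lia.
  by split; [lia|exists (Ordinal pn)].
transitivity (\sum_(e : particle N | ~~ (level e < N)%N) \sum_(i < n) F i * (place e == i.+1)%:R).
  apply: eq_bigr => e /lt[eN [i ei]]; rewrite (HF e i)// (bigD1 i)//= ei eqxx mulr1.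
  rewrite big1 ?addr0// => l li; rewrite eqSS; case: eqP => [il|]; last by rewrite mulr0.
  by case/eqP: li; apply: val_inj.
rewrite exchange_big; apply: eq_bigr => i _.
have /siteP[e0 [ek ei]] : @site N N i.+1 by have := ltn_ord i; rewrite /site; lia.
rewrite (bigD1 e0) ?ek ?ltnn//= ei eqxx mulr1 big1 ?addr0// => e /andP[eN ee0].
case: eqP => [eE|]; last by rewrite mulr0.
by case/eqP: ee0; apply: particle_inj; [have [] := lt e eN; rewrite ek|rewrite ei].
Qed.

(** The total reversed flux into [y]: its contributions from cascades stopping
    below the top row keep the top row fixed, those reaching the top row give
    the rates [f_rate]. *)
Lemma weight_dynamics z y :
  \sum_(x <- fiber z) weight q a x * dynamics q a x y =
  (f_rate q z (top y) + (top y == z)%:R *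
     (\sum_(e : particle N | (level e < N)%N) (right_flux q a (val y) (level e) (place e) +
                                  left_flux q a (val y) (level e) (place e)) -
      \sum_p (rate_r q a (val y) p + rate_l q a (val y) p))) * weight q a y.
Proof.
pose jr x p e : R := (end_right (val x) p e && (val y == jump_right (val x) p))%:R.
pose jl x p e : R := (end_left (val x) p e && (val y == jump_left (val x) p))%:R.
pose w := @weight R n N q a.
transitivity (\sum_e (\sum_(x <- fiber z) \sum_p (w x * rate_r q a (val x) p) * jr x p e) +
   \sum_e (\sum_(x <- fiber z) \sum_p (w x * rate_l q a (val x) p) * jl x p e) -
   \sum_(x <- fiber z) w x * (x == y)%:R * \sum_p (rate_r q a (val x) p + rate_l q a (val x) p)).
  rewrite [X in X + _ - _]exchange_big [X in _ + X - _]exchange_big /=.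
  rewrite -big_split -sumrB; apply: eq_bigr => x _.
  rewrite [X in X + _ - _]exchange_big [X in _ + X - _]exchange_big /=.
  rewrite dynamicsE !mulr_sumr -big_split -sumrB; apply: eq_bigr => p _ /=.
  rewrite -!mulr_sumr.
  have -> : \sum_e jr x p e = (val y == jump_right (val x) p)%:R.
    have [e0 uni] := end_right_unique (val x) p.
    rewrite (bigD1 e0)//= /jr uni eqxx big1 ?addr0// => e /negbTE ee0.
    by rewrite uni ee0.
  have -> : w x * rate_l q a (val x) p * (\sum_e jl x p e) =
      w x * rate_l q a (val x) p * (val y == jump_left (val x) p)%:R.
    have [fr|/free_left_rate ->] := boolP (free_left (val x) (level p) (place p)); last first.
      by rewrite !mulr0 !mul0r.
    have pos : (0 < ent (val x) (level p) (place p))%N.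
      by move: fr; rewrite /free_left; lia.
    have [e0 uni] := end_left_unique pos; congr (_ * _).
    rewrite (bigD1 e0)//= /jl uni eqxx big1 ?addr0// => e /negbTE ee0.
    by rewrite uni ee0.
  by rewrite /w; ring.
rewrite [X in X + _ - _](bigID (fun e => (level e < N)%N))/=.
rewrite [X in _ + X - _](bigID (fun e => (level e < N)%N))/=.
rewrite (top_particle_sum (right_sum_top z y)) (top_particle_sum (left_sum_top z y)).
rewrite (eq_bigr _ (fun e eN => right_sum_lt z y eN)).
rewrite [X in _ + (X + _) - _](eq_bigr _ (fun e eN => left_sum_lt z y eN)).
have -> : \sum_(x <- fiber z) w x * (x == y)%:R *
      \sum_p (rate_r q a (val x) p + rate_l q a (val x) p) =
    (top y == z)%:R * (w y * \sum_p (rate_r q a (val y) p + rate_l q a (val y) p)).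
  have [yz|yz] := boolP (top y == z).
    rewrite (bigD1_seq y) ?uniq_fiber ?mem_fiber//= eqxx [X in _ + X]big1 ?addr0 ?mulr1 ?mul1r//.
    by move=> x /negbTE ->; rewrite mulr0 mul0r.
  rewrite mul0r big1_seq// => x /andP[_]; rewrite mem_fiber => /eqP xz.
  case: eqP => [xy|]; last by rewrite mulr0 mul0r.
  by rewrite -xz xy eqxx in yz.
rewrite -!mulr_sumr -!mulr_suml /f_rate !big_split /=.
by rewrite /w; ring.
Qed.


Section Balance.
Variables (y : pattern N) (k : nat).
Hypothesis kN : (0 < k <= N)%N.

(* [right_flux] and [left_flux] from level [k - 1] into level [k], without the
   constants [abar] *)
Let A j : R :=
  (1 - qpow q (omap succn (gap (xent (val y) k.-1 j.-1) (ent (val y) k.-1 j)))) *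
  (1 - q ^+ (ent (val y) k.-1 j - ent (val y) k j.+1)) /
  (1 - q ^+ (ent (val y) k j - ent (val y) k.-1 j + 1)).

Let B j : R :=
  (1 - q ^+ (ent (val y) k.-1 j - ent (val y) k.-1 j.+1 + 1)) *
  (1 - q ^+ (ent (val y) k j - ent (val y) k.-1 j)) /
  (1 - q ^+ (ent (val y) k.-1 j - ent (val y) k j.+1 + 1)).

Let c j : R := qpow q (gap (xent (val y) k.-1 j.-1) (ent (val y) k j)).
Let h j : R := q ^+ (ent (val y) k j - ent (val y) k.-1 j).

Let c_succ j : (0 < j)%N -> c j.+1 = q ^+ (ent (val y) k.-1 j - ent (val y) k j.+1).
Proof. by case: j. Qed.

Let out j k' : (k' <= k)%N -> (k'.+1./2 < j)%N -> ent (val y) k' j = 0%N.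
Proof. by move=> kk kj; rewrite ent_out// /site; lia. Qed.

Let right_diff j : (0 < j)%N -> rate_right q (val y) k j - A j = c j.+1 - c j.
Proof.
move=> j0; have := @ent_le N y k j kN j0; rewrite c_succ// /rate_right /A /c.
have nz : 1 - q ^+ (ent (val y) k j - ent (val y) k.-1 j + 1) != 0.
  by rewrite addn1 onem_neq0.
move=> /andP[h1 h2].
have -> : (ent (val y) k j - ent (val y) k j.+1 + 1 =
  (ent (val y) k j - ent (val y) k.-1 j + 1) +
  (ent (val y) k.-1 j - ent (val y) k j.+1))%N by lia.
have [j1|j1] := eqVneq j 1%N.
  subst j; rewrite /= subr0; move: (ent (val y) k 1 - _ + 1)%N nz => X nz.
  move: (ent (val y) k.-1 1 - _)%N => Y.
  by rewrite exprD; move: (q ^+ X) (q ^+ Y) nz => s t nz; rewrite subr0 !mul1r; field.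
have -> : xent (val y) k.-1 j.-1 = Some (ent (val y) k.-1 j.-1).
  by case: (j) j0 j1 => [|[|j']].
have := @ent_le N y k j.-1 kN ltac:(lia); rewrite prednK// => /andP[h3 _].
rewrite /= .
have -> : (ent (val y) k.-1 j.-1 - ent (val y) k.-1 j).+1 =
  ((ent (val y) k j - ent (val y) k.-1 j + 1) +
   (ent (val y) k.-1 j.-1 - ent (val y) k j))%N by lia.
move: (ent (val y) k j - ent (val y) k.-1 j + 1)%N nz => X nz.
move: (ent (val y) k.-1 j - _)%N (ent (val y) k.-1 j.-1 - _)%N => Y X'.
rewrite !exprD; move: (q ^+ X) (q ^+ Y) (q ^+ X') nz => s t r nz.
by field.
Qed.

Let left_diff j : (0 < j)%N -> rate_left q (val y) k j.+1 - B j = h j - h j.+1.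
Proof.
move=> j0; have := @ent_le N y k j kN j0; have := @ent_le N y k j.+1 kN isT.
rewrite /rate_left /B /h; move: (val y) => u /andP[h1 h2] /andP[h3 h4].
rewrite !(xent_succ _ _ j0) /=.
have nz : 1 - q ^+ (ent u k.-1 j - ent u k j.+1).+1 != 0 by exact: onem_neq0.
have -> : (ent u k j - ent u k j.+1).+1 =
  ((ent u k.-1 j - ent u k j.+1).+1 +
  (ent u k j - ent u k.-1 j))%N by lia.
have -> : (ent u k.-1 j - ent u k.-1 j.+1 + 1 =
  ((ent u k.-1 j - ent u k j.+1).+1 +
  (ent u k j.+1 - ent u k.-1 j.+1)))%N by lia.
rewrite addn1; move: (ent u k.-1 j - _ k j.+1).+1 nz => X nz.
move: (ent u k j - _)%N (ent u k j.+1 - _)%N => Y X'.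
rewrite !exprD; move: (q ^+ X) (q ^+ Y) (q ^+ X') nz => s t r nz.
by field.
Qed.

(** The right rates of level [k] and the fluxes through level [k - 1] have the same
    denominators, and their differences telescope. For odd [k] the extra particle
    of level [k] is matched with a vanishing flux. *)
Lemma right_balance : \sum_(1 <= j < k.+1./2.+1) rate_right q (val y) k j -
   \sum_(1 <= j < k./2.+1) A j = q ^+ ent (val y) k.-1 k.+1./2.
Proof.
have -> : \sum_(1 <= j < k./2.+1) A j = \sum_(1 <= j < k.+1./2.+1) A j.
  rewrite [RHS](big_cat_nat (n := k./2.+1))//=; last lia.
  rewrite [X in _ + X]big_nat_cond [X in _ + X]big1 ?addr0// => j hj.
  by rewrite /A (@out j.+1 k) ?(@out j k.-1) ?sub0n ?expr0 ?subrr ?mulr0 ?mul0r//; lia.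
rewrite -sumrB big_nat (eq_bigr (fun j => c j.+1 - c j)) => [|j hj]; last first.
  by rewrite right_diff//; lia.
rewrite -big_nat telescope_sumr//.
rewrite c_succ; last lia.
by rewrite (@out _ k)// subn0 /c /= subr0.
Qed.

Lemma left_balance : \sum_(1 <= j < k.+1./2.+1) rate_left q (val y) k j -
   \sum_(1 <= j < k./2.+1) B j =
   1 - q ^+ (ent (val y) k k./2.+1 - ent (val y) k.-1 k./2.+1).
Proof.
have -> : \sum_(1 <= j < k.+1./2.+1) rate_left q (val y) k j =
    \sum_(1 <= j < k./2.+2) rate_left q (val y) k j.
  rewrite [RHS](big_cat_nat (n := k.+1./2.+1))//=; last lia.
  rewrite [X in _ + X]big_nat_cond [X in _ + X]big1 ?addr0// => j hj.
  by rewrite /rate_left (@out j k) ?sub0n ?expr0 ?subrr ?mul0r//; lia.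
rewrite big_ltn// big_add1 /= addrAC -addrA [X in _ + X]addrC -sumrB big_nat.
rewrite (eq_bigr (fun j => - (h j.+1 - h j))) => [|j hj]; last first.
  by rewrite left_diff ?opprB//; lia.
rewrite -big_nat sumrN telescope_sumr// /rate_left /= subr0 divr1 mulr1.
by rewrite -/(h 1) opprB addrA subrK.
Qed.

Lemma level_balance :
  \sum_(1 <= j < k./2.+1) (right_flux q a (val y) k.-1 j + left_flux q a (val y) k.-1 j) -
  \sum_(1 <= j < k.+1./2.+1) (abar a k * rate_right q (val y) k j +
                              (abar a k)^-1 * rate_left q (val y) k j) =
  - (abar a k * q ^+ ent (val y) k.-1 k.+1./2 +
     (abar a k)^-1 * (1 - q ^+ (ent (val y) k k./2.+1 - ent (val y) k.-1 k./2.+1))).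
Proof.
rewrite -right_balance -left_balance.
have kk : k.-1.+1 = k by lia.
have lt : (k.-1 < N)%N by lia.
rewrite (eq_bigr (fun j => abar a k * A j + (abar a k)^-1 * B j)) => [|j _].
  rewrite !big_split /= -!mulr_sumr; ring.
by rewrite /right_flux /left_flux lt kk.
Qed.

End Balance.

(** Summing [level_balance]: for the two levels [2 i + 1] and [2 i + 2], which share
    the parameter [a_i], the terms in [q] cancel at the left wall and a constant
    remains. When [N] is odd the last level has no partner. *)
Lemma diagonal_rate y :
  \sum_(e : particle N | (level e < N)%N) (right_flux q a (val y) (level e) (place e) +
                                           left_flux q a (val y) (level e) (place e)) -
  \sum_p (rate_r q a (val y) p + rate_l q a (val y) p) = Q_rate N q a (top y) (top y).
Proof.
pose G k j := right_flux q a (val y) k j + left_flux q a (val y) k j.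
pose D k := abar a k * q ^+ ent (val y) k.-1 k.+1./2 +
   (abar a k)^-1 * (1 - q ^+ (ent (val y) k k./2.+1 - ent (val y) k.-1 k./2.+1)).
have -> : \sum_(e : particle N | (level e < N)%N) G (level e) (place e) =
    \sum_(1 <= k < N.+1) \sum_(1 <= j < k./2.+1) G k.-1 j.
  rewrite big_mkcond (particle_sum (fun k j => if (k < N)%N then G k j else 0)).
  rewrite big_nat_recr ?ltnS//= [X in _ + X]big1 ?addr0; last by move=> j _; rewrite ltnn.
  rewrite [RHS]big_ltn ?ltnS// [X in _ = X + _]big_geq// add0r [RHS]big_add1.
  rewrite big_nat [RHS]big_nat; apply: eq_bigr => k /andP[_ kN].
  by apply: eq_bigr => j _; rewrite kN.
rewrite (particle_sum (fun k j => abar a k * rate_right q (val y) k j +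
                              (abar a k)^-1 * rate_left q (val y) k j)).
rewrite -sumrB big_nat (eq_bigr (fun k => - D k)) => [|k hk]; last first.
  by rewrite level_balance//; lia.
rewrite -big_nat sumrN.
(* With [i] numbered from 0, both levels [2 i + 1] and [2 i + 2] use [a`_i]. *)
have abar_odd i : abar a i.*2.+1 = a`_i.
  by rewrite /abar /= odd_double /= doubleK.
have abar_even i : abar a i.*2.+2 = (a`_i)^-1.
  have e1 : (i.*2.+1)./2 = i by lia.
  have e2 : odd i.*2.+2 = false by rewrite /= odd_double.
  by rewrite /abar e2; congr (_`_ _)^-1.
have out k j : (k <= N)%N -> (k.+1./2 < j)%N -> ent (val y) k j = 0%N.
  by move=> kk kj; rewrite ent_out// /site; lia.
have Dodd i : (i.*2 < N)%N -> D i.*2.+1 =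
    a`_i + (a`_i)^-1 * (1 - q ^+ ent (val y) i.*2.+1 i.+1).
  move=> iN.
  have e1 : i.*2.+2./2 = i.+1 by lia.
  have e2 : i.*2.+1./2 = i by lia.
  have e3 : ent (val y) i.*2 i.+1 = 0%N by apply: out; lia.
  by rewrite /D abar_odd e1 e2 -[i.*2.+1.-1]/(i.*2) e3 expr0 mulr1 subn0.
have Deven i : (i.*2.+1 < N)%N -> D i.*2.+2 = (a`_i)^-1 * q ^+ ent (val y) i.*2.+1 i.+1.
  move=> iN.
  have e1 : i.*2.+3./2 = i.+1 by lia.
  have e2 : i.*2.+2./2 = i.+1 by lia.
  have e3 : ent (val y) i.*2.+2 i.+2 = 0%N by apply: out; lia.
  rewrite /D abar_even e1 e2 -[i.*2.+2.-1]/(i.*2.+1) e3.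
  by rewrite sub0n expr0 subrr mulr0 addr0.
have pairs m : (m.*2 <= N)%N ->
    \sum_(1 <= k < m.*2.+1) D k = \sum_(0 <= i < m) (a`_i + (a`_i)^-1).
  elim: m => [|m IH] mN; first by rewrite !big_geq.
  rewrite doubleS (big_nat_recr m.*2.+2)// (big_nat_recr m.*2.+1)// [RHS]big_nat_recr//.
  rewrite IH ?Dodd ?Deven; [|lia..].
  by rewrite /= -!addrA -mulrDr subrK mulr1.
rewrite /Q_rate eqxx; case: ifP => oN.
  have eN : N = n.-1.*2.+1 by lia.
  have -> : \sum_(1 <= k < N.+1) D k = \sum_(1 <= k < n.-1.*2.+1) D k + D n.-1.*2.+1.
    by rewrite -big_nat_recr//=; congr (\sum_(_ <= _ < _.+1) _).
  rewrite pairs; last lia.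
  rewrite Dodd; last lia.
  have -> : part (top y) n = ent (val y) n.-1.*2.+1 n.-1.+1.
    have := part_top y n.-1; rewrite (prednK n_gt0) => ->.
    by congr ent.
  by rewrite opprD opprD addrA.
have eN : N = n.*2 by lia.
have -> : \sum_(1 <= k < N.+1) D k = \sum_(1 <= k < n.*2.+1) D k.
  by congr (\sum_(_ <= _ < _.+1) _).
by rewrite pairs//; lia.
Qed.

Lemma raised_irrefl (i : 'I_n) z : raised i z z = false.
Proof. by apply/negP => /forallP/(_ i); rewrite eqxx; lia. Qed.

Lemma gibbs_dynamics z y :
  \sum_(x <- fiber z) gibbs q a z x * dynamics q a x y =
  Q_rate N q a z (top_row n y) * gibbs q a (top_row n y) y.
Proof.
have P0 z' : Phat N q a z' != 0 by rewrite gt_eqF// Phat_gt0.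
have -> : \sum_(x <- fiber z) gibbs q a z x * dynamics q a x y =
    (\sum_(x <- fiber z) weight q a x * dynamics q a x y) / Phat N q a z.
  rewrite mulr_suml big_seq [RHS]big_seq; apply: eq_bigr => x.
  by rewrite mem_fiber// /gibbs => ->; rewrite mulrAC.
rewrite weight_dynamics// diagonal_rate// /gibbs eqxx.
have [<-|zy] := eqVneq (top_row n y) z.
  rewrite mul1r /f_rate big1 ?add0r ?mulrA// => i _.
  by rewrite raised_irrefl !mulr0n addr0.
rewrite mul0r addr0 /Q_rate eq_sym (negbTE zy).
by field; rewrite !P0.
Qed.

Let onem_qX_ge0 m : 0 <= 1 - q ^+ m.
Proof. by rewrite subr_ge0; apply: exprn_ile1; apply: ltW. Qed.

Lemma Q_rate_ge0 z z' : z != z' -> 0 <= Q_rate N q a z z'.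
Proof.
move=> zz'; rewrite /Q_rate (negbTE zz') mulr_ge0//.
  by apply: divr_ge0; apply: ltW; apply: Phat_gt0.
apply: sumr_ge0 => i _; rewrite addr_ge0// mulrn_wge0//.
by case: (gap _ _) => [m|] //=; rewrite subr0.
Qed.

Lemma Q_rate_bounded z : `|Q_rate N q a z z| <= \sum_(0 <= i < n) (a`_i + (a`_i)^-1).
Proof.
have an i : (i < n)%N -> 0 < a`_i.
  by move=> i_n; rewrite -[i]/(nat_of_ord (Ordinal i_n)) -tnth_nth.
have s0 m : (m <= n)%N -> 0 <= \sum_(0 <= i < m) (a`_i + (a`_i)^-1).
  move=> mn; rewrite big_nat; apply: sumr_ge0 => i im.
  by rewrite addr_ge0 ?invr_ge0// ltW// an//; lia.
rewrite /Q_rate eqxx; case: ifP => _; last by rewrite normrN ger0_norm// s0.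
have -> : \sum_(0 <= i < n) (a`_i + (a`_i)^-1) =
    \sum_(0 <= i < n.-1) (a`_i + (a`_i)^-1) + (a`_n.-1 + (a`_n.-1)^-1).
  by rewrite -big_nat_recr//; congr (\sum_(_ <= _ < _) _); rewrite prednK.
have := s0 n.-1 (leq_pred n); have a0 := an n.-1 ltac:(lia).
have ai0 : 0 < (a`_n.-1)^-1 by rewrite invr_gt0.
have t0 : 0 <= (a`_n.-1)^-1 * (1 - q ^+ part z n) by rewrite mulr_ge0// ltW.
have t1 : (a`_n.-1)^-1 * (1 - q ^+ part z n) <= (a`_n.-1)^-1.
  apply: ler_piMr; first exact: ltW.
  by rewrite gerBl; apply: exprn_ge0; exact: ltW.
by move=> s; rewrite ler_norml; apply/andP; split; lra.
Qed.

End Generator.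

End TopRow.

Theorem theorem5p1p1 (R : realType) (n N : nat) (q : R) (a : n.-tuple R)
    (d : measure_display) (T : measurableType d) (P : probability T R)
    (Z : R -> T -> pattern N) (z : cone n)
    (n_gt0 : (0 < n)%N) (hN : N = (2 * n)%N \/ N = (2 * n - 1)%N)
    (q_gt0 : 0 < q) (q_lt1 : q < 1) (a_gt0 : forall i : 'I_n, 0 < tnth a i)
    (Z_markov : markov_process P Z (dynamics q a))
    (Z_init : forall x : pattern N,
      P (Z 0 @^-1` [set x]) = (gibbs q a z x)%:E) :
  [/\ P [set w | top_row n (Z 0 w) = z] = 1%E,
      markov_process P (fun t w => top_row n (Z t w)) (Q_rate N q a) &
      forall t : R, 0 < t ->
        cond_law P (history (fun s w => top_row n (Z s w)) t) (Z t)
          (fun w => gibbs q a (top_row n (Z t w)))].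
Proof.
have hn : N.+1./2 = n by lia.
have [] := @markov_function R (pattern N) (cone n) (@top_row n N) (@fiber n N)
    (@uniq_fiber n N) (@mem_fiber n N n_gt0 hn) (gibbs q a) (dynamics q a) (Q_rate N q a)
    (@successors N) (\sum_(0 <= i < n) (a`_i + (a`_i)^-1)) _ _ _ _ _ _ _ _ _ d T P Z z
    Z_markov Z_init.
- by move=> z' x; exact: gibbs_ge0.
- by move=> z' x; exact: gibbs_off.
- by move=> z'; exact: gibbs_sum.
- by move=> x y; exact: dynamics_off.
- by move=> x; exact: dynamics_sum.
- by move=> x; exact: undup_uniq.
- by move=> z' y; exact: gibbs_dynamics.
- by move=> z' z''; exact: Q_rate_ge0.
- by move=> z'; exact: Q_rate_bounded.
by move=> top0 markov_top law; split=> // t t0; apply: law; exact: ltW.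
Qed.
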